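(* Let $m\ge 1$ and let $\alpha_1,\ldots,\alpha_m$ be rational numbers, none of which lies in $\{0,-1,-2,\ldots\}$, such that $\alpha_i-\alpha_j\notin\mathbb{Z}$ for $i\neq j$. Write $\alpha_j=r_j/s_j$ with coprime integers $r_j$, $s_j\ge1$, and let $s=\operatorname{lcm}\{s_1,\ldots,s_m\}$. Let $a\in\mathbb{Z}\setminus\{0\}$ and $(\ell_0,\ell_1,\ldots,\ell_m)\in\mathbb{Z}^{m+1}\setminus\{0\}$, and for each prime $p\nmid s$ let $L_p=\ell_0+\ell_1\varphi_{1,p}(a)+\cdots+\ell_m\varphi_{m,p}(a)\in\mathbb{Q}_p$. Then: (i) there are infinitely many primes $p\nmid s$ with $L_p\neq 0$; (ii) there is a positive constant $H_0$ depending only on $\alpha_1,\ldots,\alpha_m$, $m$ and $a$ such that, putting $h=\max\{|\ell_0|,|\ell_1|,\ldots,|\ell_m|\}$, $H=\max\{h,H_0\}$ and \[ \tilde H=\left[\frac{\log H}{\log\log H}\left(1+\frac{\frac54(m+1)+6}{\sqrt{\log\log H}}\right)\right], \] there is a prime $p\nmid s$ with $e^{\sqrt{\log\tilde H}}<p\le m\tilde H$ and $L_p\neq0$.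
   Context: Pochhammer symbol: $(\alpha)_0=1$, $(\alpha)_n=\alpha(\alpha+1)\cdots(\alpha+n-1)$ for $n\ge1$. For $j=1,\ldots,m$ let $\varphi_j(z)=\sum_{n=0}^\infty(\alpha_j)_n z^n$. For a prime $p\nmid s$ this series converges in $\mathbb{Q}_p$ for all $|z|_p\le1$, and $\varphi_{j,p}(a)$ denotes its sum in $\mathbb{Q}_p$ at $z=a$. $[x]$ denotes the integer part of $x$. *)

(* Defs.v *)
From HB Require Import structures.
From mathcomp Require Import all_boot all_order all_algebra.
From mathcomp Require Import generic_quotient ring_quotient archimedean.
From mathcomp Require Import boolp classical_sets functions cardinality reals.
From mathcomp Require Import topology sequences exp.
From mathcomp Require Import lra ring zify.

Set Implicit Arguments.
Unset Strict Implicit.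
Unset Printing Implicit Defensive.

Import Order.TTheory GRing.Theory Num.Theory.
Local Open Scope classical_set_scope.
Local Open Scope ring_scope.

Definition padic_abs (p : nat) (q : rat) : rat :=
  if q == 0 then 0
  else p%:R ^ ((logn p `|denq q|)%:Z - (logn p `|numq q|)%:Z).

Section PadicAbs.
Variables (p : nat) (p_pr : prime p).
Local Notation abs := (padic_abs p).

Let p0 : (p%:R : rat) != 0.
Proof. by rewrite pnatr_eq0 -lt0n prime_gt0. Qed.

Lemma padic_abs0 : abs 0 = 0. Proof. by rewrite /padic_abs eqxx. Qed.

Lemma padic_abs_frac (a b : int) : a != 0 -> b != 0 ->
  abs (a%:~R / b%:~R) = p%:R ^ ((logn p `|b|)%:Z - (logn p `|a|)%:Z).
Proof.
move=> a0 b0; set q := a%:~R / b%:~R.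
have q0 : q != 0 by rewrite mulf_neq0 ?invr_eq0 ?intr_eq0.
rewrite /padic_abs (negbTE q0).
have E : numq q * b = a * denq q.
  apply/(@intr_inj rat); rewrite !rmorphM /= numqE.
  by rewrite mulrAC {1}/q divfK // intr_eq0.
have := congr1 (fun z : int => logn p `|z|) E.
rewrite !abszM !lognM ?absz_gt0 ?numq_eq0 ?denq_neq0 // => {}E.
congr (_ ^ _); lia.
Qed.

Lemma padic_absE (a : int) : a != 0 -> abs a%:~R = p%:R ^- logn p `|a|.
Proof.
move=> a0; have := padic_abs_frac a0 (oner_neq0 _); rewrite divr1 => ->.
by rewrite logn1 sub0r -exprnN.
Qed.

Lemma padic_abs_eq0 q : (abs q == 0) = (q == 0).
Proof.
rewrite /padic_abs; have [_|_] := eqVneq q 0; first exact: eqxx.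
by rewrite (negbTE (expfz_neq0 _ p0)).
Qed.

Lemma padic_abs_ge0 q : 0 <= abs q.
Proof. by rewrite /padic_abs; case: eqP => // _; rewrite exprz_ge0. Qed.

Lemma padic_abs1 : abs 1 = 1.
Proof. by rewrite (padic_absE (oner_neq0 _)) logn1 expr0 invr1. Qed.

Lemma padic_absM x y : abs (x * y) = abs x * abs y.
Proof.
have [->|x0] := eqVneq x 0; first by rewrite mul0r padic_abs0 mul0r.
have [->|y0] := eqVneq y 0; first by rewrite mulr0 padic_abs0 mulr0.
have -> : x * y = (numq x * numq y)%:~R / (denq x * denq y)%:~R.
  by rewrite -{1}[x]divq_num_den -{1}[y]divq_num_den !rmorphM /= invfM mulrACA.
rewrite padic_abs_frac ?mulf_neq0 ?numq_eq0 ?denq_neq0 //.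
rewrite /padic_abs (negbTE x0) (negbTE y0) -expfzDr //.
rewrite !abszM !lognM ?absz_gt0 ?numq_eq0 ?denq_neq0 //.
congr (_ ^ _); lia.
Qed.

Lemma padic_absN x : abs (- x) = abs x.
Proof.
by rewrite /padic_abs oppr_eq0 numqN denqN abszN.
Qed.

Lemma padic_abs_distC x y : abs (x - y) = abs (y - x).
Proof. by rewrite -padic_absN opprB. Qed.

Lemma padic_absV x : abs x^-1 = (abs x)^-1.
Proof.
have [->|x0] := eqVneq x 0; first by rewrite padic_abs0 !invr0 padic_abs0.
have ax0 : abs x != 0 by rewrite padic_abs_eq0.
by apply: (mulfI ax0); rewrite -padic_absM !divff // padic_abs1.
Qed.

Lemma padic_abs_int_le (k : nat) (a : int) :
  (p ^ k %| `|a|)%N -> abs a%:~R <= p%:R ^- k.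
Proof.
move=> pka; have [->|a0] := eqVneq a 0.
  by rewrite padic_abs0 invr_ge0 exprn_ge0.
rewrite padic_absE // lef_pV2 ?posrE ?exprn_gt0 ?ltr0n ?prime_gt0 //.
by rewrite ler_eXn2l ?ltr1n ?prime_gt1 // -pfactor_dvdn // absz_gt0.
Qed.

Lemma padic_abs_int_le1 (a : int) : abs a%:~R <= 1.
Proof. by have := @padic_abs_int_le 0 a (dvd1n _); rewrite expr0 invr1. Qed.

Lemma padic_absD x y : abs (x + y) <= Num.max (abs x) (abs y).
Proof.
have [d d0 [a [b [-> ->]]]] : exists2 d : int, d != 0 &
    exists a b : int, x = a%:~R / d%:~R /\ y = b%:~R / d%:~R.
  exists (denq x * denq y); first by rewrite mulf_neq0 ?denq_neq0.
  exists (numq x * denq y), (numq y * denq x); rewrite !rmorphM /=.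
  have dx : (denq x)%:~R != 0 :> rat by rewrite intr_eq0 denq_neq0.
  have dy : (denq y)%:~R != 0 :> rat by rewrite intr_eq0 denq_neq0.
  split; first by rewrite -{1}[x]divq_num_den; field; rewrite dx dy.
  by rewrite -{1}[y]divq_num_den; field; rewrite dx dy.
rewrite -mulrDl !padic_absM -maxr_pMl ?padic_abs_ge0 //.
rewrite ler_wpM2r ?padic_abs_ge0 // -rmorphD /=.
have [->|a0] := eqVneq a 0; first by rewrite add0r le_max lexx orbT.
have [->|b0] := eqVneq b 0; first by rewrite addr0 le_max lexx.
have key k : (p ^ k %| `|a|)%N -> (p ^ k %| `|b|)%N ->
    abs (a + b)%:~R <= p%:R ^- k.
  move=> pa pb; apply: padic_abs_int_le.
  have : ((p ^ k)%:Z %| a + b)%Z by rewrite rpredD //.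
  by rewrite dvdzE.
rewrite (padic_absE a0) (padic_absE b0); case: (leqP (logn p `|a|) (logn p `|b|)) => ab.
  rewrite le_max; apply/orP; left; apply: key; first exact: pfactor_dvdnn.
  by rewrite pfactor_dvdn ?absz_gt0.
rewrite le_max; apply/orP; right; apply: key; last exact: pfactor_dvdnn.
by rewrite pfactor_dvdn ?absz_gt0 // ltnW.
Qed.

Lemma padic_absB_lt x y e : abs x < e -> abs y < e -> abs (x - y) < e.
Proof.
move=> xe ye; apply: le_lt_trans (padic_absD _ _) _.
by rewrite padic_absN gt_max xe ye.
Qed.

Lemma padic_absD_lt x y e : abs x < e -> abs y < e -> abs (x + y) < e.
Proof.
by move=> xe ye; apply: le_lt_trans (padic_absD _ _) _; rewrite gt_max xe ye.
Qed.

Lemma padic_abs_isosceles x y : abs (x - y) < abs x -> abs y = abs x.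
Proof.
move=> xy; apply/eqP; rewrite eq_le; apply/andP; split.
  rewrite -{1}[y](subKr x); apply: le_trans (padic_absD _ _) _.
  by rewrite padic_absN ge_max lexx ltW.
rewrite leNgt; apply/negP => yx.
have : abs (x - y + y) < abs x by apply: padic_absD_lt.
by rewrite subrK ltxx.
Qed.

End PadicAbs.

(* The field of p-adic numbers: Cauchy sequences of rationals for the p-adic
   absolute value, modulo null sequences. *)
Section PadicCauchy.
Variables (p : nat) (p_pr : prime p).
Local Notation abs := (padic_abs p).

Definition padic_cauchy of prime p : {pred nat -> rat} := fun u =>
  `[< forall e : rat, 0 < e -> exists N : nat, forall m n,
       (N <= m)%N -> (N <= n)%N -> abs (u m - u n) < e >].

Lemma padic_cauchyP u : reflect (forall e : rat, 0 < e -> exists N : nat,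
    forall m n, (N <= m)%N -> (N <= n)%N -> abs (u m - u n) < e)
  (u \in padic_cauchy p_pr).
Proof. exact: asboolP. Qed.

Lemma padic_cauchy_bounded u : u \in padic_cauchy p_pr ->
  exists2 M : rat, 0 < M & forall n, abs (u n) < M.
Proof.
move=> /padic_cauchyP /(_ 1 ltr01) [N HN].
pose M0 := \sum_(i < N.+1) abs (u i).
have M00 : 0 <= M0 by apply: sumr_ge0 => i _; apply: padic_abs_ge0.
have HM0 i : (i <= N)%N -> abs (u i) <= M0.
  move=> iN; rewrite /M0 (bigD1 (Ordinal (iN : i < N.+1)%N)) //= lerDl.
  by apply: sumr_ge0 => *; apply: padic_abs_ge0.
exists (M0 + 1); first by lra.
move=> n; have [/HM0|/ltnW nN] := leqP n N; first by lra.
rewrite -(subrK (u N) (u n)); apply: padic_absD_lt => //.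
  by apply: lt_le_trans (HN _ _ nN (leqnn _)) _; lra.
by have := HM0 _ (leqnn N); lra.
Qed.

Lemma padic_cauchy_subring : subring_closed (padic_cauchy p_pr).
Proof.
split.
- apply/padic_cauchyP => e e0; exists 0%N => m n _ _.
  by rewrite subrr padic_abs0.
- move=> u v /padic_cauchyP cu /padic_cauchyP cv; apply/padic_cauchyP => e e0.
  have [N HN] := cu e e0; have [M HM] := cv e e0.
  exists (maxn N M) => m n; rewrite !geq_max => /andP[Nm Mm] /andP[Nn Mn].
  have -> : (u - v) m - (u - v) n = (u m - u n) - (v m - v n).
    by change (u m - v m - (u n - v n) = u m - u n - (v m - v n)); ring.
  by apply: padic_absB_lt => //; [apply: HN|apply: HM].
- move=> u v cu cv; apply/padic_cauchyP => e e0.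
  have [A A0 HA] := padic_cauchy_bounded cu.
  have [B B0 HB] := padic_cauchy_bounded cv.
  have [N HN] := padic_cauchyP _ cu _ (divr_gt0 e0 B0).
  have [M HM] := padic_cauchyP _ cv _ (divr_gt0 e0 A0).
  exists (maxn N M) => m n; rewrite !geq_max => /andP[Nm Mm] /andP[Nn Mn].
  have -> : (u * v) m - (u * v) n = (u m - u n) * v m + u n * (v m - v n).
    by rewrite mulrfctE; ring.
  have xy_lt x y d : 0 < d -> abs x < e / d -> abs y < d -> abs (x * y) < e.
    move=> d0 xe yd; rewrite padic_absM // -[e](divfK (lt0r_neq0 d0)).
    by apply: ltr_pM => //; apply: padic_abs_ge0.
  apply: padic_absD_lt => //; first exact: (xy_lt _ _ B B0 (HN _ _ Nm Nn)).
  by rewrite mulrC; apply: (xy_lt _ _ A A0 (HM _ _ Mm Mn)).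
Qed.

End PadicCauchy.

HB.instance Definition _ p (p_pr : prime p) :=
  GRing.isSubringClosed.Build (nat -> rat) (padic_cauchy p_pr)
    (padic_cauchy_subring p_pr).

Record padic_seq p (p_pr : prime p) :=
  PadicSeq { padic_seq_val :> nat -> rat; _ : padic_seq_val \in padic_cauchy p_pr }.

HB.instance Definition _ p (p_pr : prime p) :=
  [isSub for @padic_seq_val p p_pr].
HB.instance Definition _ p (p_pr : prime p) :=
  [Choice of padic_seq p_pr by <:].
HB.instance Definition _ p (p_pr : prime p) :=
  [SubChoice_isSubComNzRing of padic_seq p_pr by <:].

Section PadicNull.
Variables (p : nat) (p_pr : prime p).
Local Notation abs := (padic_abs p).
Implicit Types u v : padic_seq p_pr.

Definition padic_null of prime p : {pred padic_seq p_pr} := fun u =>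
  `[< forall e : rat, 0 < e -> exists N : nat, forall n,
       (N <= n)%N -> abs (u n) < e >].

Lemma padic_nullP u : reflect (forall e : rat, 0 < e -> exists N : nat,
    forall n, (N <= n)%N -> abs (u n) < e) (u \in padic_null p_pr).
Proof. exact: asboolP. Qed.

Lemma padic_seqB u v n : (u - v) n = u n - v n. Proof. by []. Qed.
Lemma padic_seqM u v n : (u * v) n = u n * v n. Proof. by []. Qed.
Lemma padic_seq1 n : (1 : padic_seq p_pr) n = 1. Proof. by []. Qed.

Lemma padic_null_ideal : idealr_closed (padic_null p_pr).
Proof.
split.
- by apply/padic_nullP => e e0; exists 0%N => n _; rewrite padic_abs0.
- apply/negP => /padic_nullP /(_ 1 ltr01) [N /(_ N (leqnn N))].
  by rewrite [abs _](padic_abs1 p_pr) ltxx.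
- move=> a u v /padic_nullP nu /padic_nullP nv; apply/padic_nullP => e e0.
  have [A A0 HA] := padic_cauchy_bounded (valP a).
  have [N HN] := nu _ (divr_gt0 e0 A0); have [M HM] := nv _ e0.
  exists (maxn N M) => n; rewrite !geq_max => /andP[Nn Mn].
  have -> : (a * u + v) n = u n * a n + v n by rewrite [u n * _]mulrC.
  apply: (padic_absD_lt p_pr) (HM n Mn).
  rewrite padic_absM // -[e](divfK (lt0r_neq0 A0)).
  by apply: ltr_pM (HN _ Nn) (HA n); apply: padic_abs_ge0.
Qed.

End PadicNull.

HB.instance Definition _ p (p_pr : prime p) :=
  isIdealr.Build (padic_seq p_pr) (padic_null p_pr) (padic_null_ideal p_pr).

Definition padic p (p_pr : prime p) : Type := {ideal_quot (padic_null p_pr)}.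

HB.instance Definition _ p (p_pr : prime p) := GRing.ComNzRing.on (padic p_pr).

Definition padic_pi p (p_pr : prime p) (u : padic_seq p_pr) : padic p_pr :=
  \pi_({ideal_quot (padic_null p_pr)})%qT u.

Section PadicField.
Variables (p : nat) (p_pr : prime p).
Local Notation abs := (padic_abs p).
Implicit Types (u v : padic_seq p_pr) (x y : padic p_pr).

Lemma padic_pi_eq u v : (padic_pi u == padic_pi v) = (u - v \in padic_null p_pr).
Proof. exact/esym/Quotient.idealrBE. Qed.

Lemma padic_pi_eq0 u : (padic_pi u == 0) = (u \in padic_null p_pr).
Proof.
have -> : 0 = padic_pi (0 : padic_seq p_pr).
  exact/esym/(@pi_zeror _ _ _ _ _ {ideal_quot (padic_null p_pr)}).
by rewrite padic_pi_eq subr0.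
Qed.

Lemma padic_piE x : exists u, x = padic_pi u.
Proof. by exists (repr (x : {ideal_quot (padic_null p_pr)})); rewrite /padic_pi reprK. Qed.

Lemma padic_pi_is_zmod : zmod_morphism (@padic_pi p p_pr).
Proof.
move=> u v; rewrite /padic_pi.
by rewrite (@pi_addr _ _ _ _ _ {ideal_quot (padic_null p_pr)})
  (@pi_oppr _ _ _ _ _ {ideal_quot (padic_null p_pr)}).
Qed.

Lemma padic_pi_is_monoid : monoid_morphism (@padic_pi p p_pr).
Proof.
split; first exact: (@pi_oner _ _ _ _ _ _ _ {ideal_quot (padic_null p_pr)}).
exact: (@pi_mulr _ _ _ _ _ _ _ {ideal_quot (padic_null p_pr)}).
Qed.

HB.instance Definition _ := GRing.isZmodMorphism.Build
  (padic_seq p_pr) (padic p_pr) (@padic_pi p p_pr) padic_pi_is_zmod.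
HB.instance Definition _ := GRing.isMonoidMorphism.Build
  (padic_seq p_pr) (padic p_pr) (@padic_pi p p_pr) padic_pi_is_monoid.

Lemma padic_nonnull u : u \notin padic_null p_pr ->
  exists2 c : rat, 0 < c &
    exists N : nat, forall n, (N <= n)%N -> abs (u n) = c.
Proof.
move=> /padic_nullP /existsNP[e] /not_implyP[e0] /forallNP nu.
have [N HN] := padic_cauchyP p_pr _ (valP u) _ e0.
have /existsNP[n /not_implyP[Nn /negP]] := nu N; rewrite -leNgt => en.
exists (abs (u n)); first exact: lt_le_trans en.
exists N => m Nm; apply: (padic_abs_isosceles p_pr).
exact: lt_le_trans (HN _ _ Nn Nm) en.
Qed.

Lemma padic_inv_ex x : x != 0 -> exists y, y * x = 1.
Proof.
have [u ->] := padic_piE x; rewrite padic_pi_eq0 => /padic_nonnull[c c0 [N HN]].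
have vP : (fun n => (u n)^-1) \in padic_cauchy p_pr.
  apply/padic_cauchyP => e e0.
  have ecc : 0 < e * (c * c) by rewrite !mulr_gt0.
  have [M HM] := padic_cauchyP p_pr _ (valP u) _ ecc.
  exists (maxn N M) => m n; rewrite !geq_max => /andP[Nm Mm] /andP[Nn Mn].
  have um0 : u m != 0 by rewrite -(padic_abs_eq0 p_pr) HN // gt_eqF.
  have un0 : u n != 0 by rewrite -(padic_abs_eq0 p_pr) HN // gt_eqF.
  have -> : (u m)^-1 - (u n)^-1 = (u n - u m) * ((u m)^-1 * (u n)^-1).
    by field; rewrite um0 un0.
  rewrite !padic_absM // !padic_absV // !HN // -invfM.
  by rewrite ltr_pdivrMr ?mulr_gt0 //; apply: HM.
exists (padic_pi (PadicSeq vP)); rewrite -rmorphM /= -(rmorph1 (@padic_pi p p_pr)).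
apply/eqP; rewrite padic_pi_eq; apply/padic_nullP => e e0; exists N => n Nn.
have un0 : u n != 0 by rewrite -(padic_abs_eq0 p_pr) HN // gt_eqF.
have -> : (PadicSeq vP * u - 1) n = (u n)^-1 * u n - 1 by [].
by rewrite mulVf // subrr padic_abs0.
Qed.

Definition padic_inv x : padic p_pr := xget 0 [set y | y * x = 1].

Lemma padic_mulVx x : x != 0 -> padic_inv x * x = 1.
Proof.
by move=> /padic_inv_ex[y yx]; rewrite /padic_inv; case: xgetP => // /(_ y).
Qed.

Lemma padic_inv0 : padic_inv 0 = 0.
Proof.
rewrite /padic_inv; case: xgetP => // y _ /= /eqP.
by rewrite mulr0 eq_sym oner_eq0.
Qed.

HB.instance Definition _ :=
  GRing.ComNzRing_isField.Build (padic p_pr) padic_mulVx padic_inv0.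

End PadicField.

Section PadicNorm.
Variables (p : nat) (p_pr : prime p).
Local Notation abs := (padic_abs p).
Implicit Types (u v : padic_seq p_pr) (x y : padic p_pr).

(* |x|_p = lim |u n|_p for any sequence u representing x; it is rational *)
Definition padic_norm x : rat := xget 0 [set r : rat |
  forall e : rat, 0 < e -> exists N : nat, forall n, (N <= n)%N ->
    `| abs (repr (x : {ideal_quot (padic_null p_pr)}) n) - r | < e].

Lemma padic_abs_rev_triangle (a b : rat) : `| abs a - abs b | <= abs (a - b).
Proof.
have H c d : abs c <= abs (c - d) + abs d.
  rewrite -{1}[c](subrK d); apply: le_trans (padic_absD p_pr _ _) _.
  by rewrite ge_max lerDl lerDr !padic_abs_ge0.
have := H a b; have := H b a; rewrite padic_abs_distC ler_norml; lra.
Qed.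

Lemma padic_norm_pi u (r : rat) :
  (forall e : rat, 0 < e -> exists N : nat, forall n, (N <= n)%N ->
     `| abs (u n) - r | < e) -> padic_norm (padic_pi u) = r.
Proof.
move=> ur; rewrite /padic_norm; set w := repr _.
have : u - w \in padic_null p_pr.
  by rewrite -padic_pi_eq {2}/padic_pi /w reprK.
move=> /padic_nullP uw.
have wr e : 0 < e -> exists N : nat, forall n, (N <= n)%N ->
    `| abs (w n) - r | < e.
  move=> e0; have e20 : 0 < e / 2 by lra.
  have [N HN] := ur _ e20; have [M HM] := uw _ e20.
  exists (maxn N M) => n; rewrite geq_max => /andP[Nn Mn].
  have := HN n Nn; have : abs (u n - w n) < e / 2 := HM n Mn.
  have := padic_abs_rev_triangle (u n) (w n).
  rewrite ler_norml !ltr_norml; lra.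
case: xgetP => [s _ ws|/(_ r)]; last by move/(_ wr).
apply/eqP; apply/negPn/negP => sr.
have d0 : 0 < `|s - r| / 2 by rewrite divr_gt0 // normr_gt0 subr_eq0.
have [N HN] := ws _ d0; have [M HM] := wr _ d0.
have := HN _ (leq_maxl N M); have := HM _ (leq_maxr N M).
rewrite distrC; set a := abs _ => A B.
have := ler_normD (r - a) (a - s); rewrite addrA subrK (distrC r s); lra.
Qed.

Lemma padic_norm_const u (c : rat) (N : nat) :
  (forall n, (N <= n)%N -> abs (u n) = c) -> padic_norm (padic_pi u) = c.
Proof.
move=> uc; apply: padic_norm_pi => e e0; exists N => n Nn.
by rewrite uc // subrr normr0.
Qed.

Lemma padic_norm0 : padic_norm 0 = 0.
Proof.
rewrite -(rmorph0 (@padic_pi p p_pr)).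
by apply: (@padic_norm_const _ _ 0) => n _; apply: padic_abs0.
Qed.

Variant padic_norm_spec u : rat -> Prop :=
| PadicNormNull of (forall e : rat, 0 < e -> exists N : nat, forall n,
    (N <= n)%N -> abs (u n) < e) & padic_pi u = 0 : padic_norm_spec u 0
| PadicNormConst c N of 0 < c & padic_pi u != 0 &
    (forall n, (N <= n)%N -> abs (u n) = c) : padic_norm_spec u c.

Lemma padic_normP u : padic_norm_spec u (padic_norm (padic_pi u)).
Proof.
have [u0|u0] := boolP (u \in padic_null p_pr).
  have /eqP u0' : padic_pi u == 0 by rewrite padic_pi_eq0.
  by rewrite u0' padic_norm0; constructor => //; apply/padic_nullP.
have [c c0 [N HN]] := padic_nonnull u0.
by rewrite (padic_norm_const HN); apply: (PadicNormConst c0 _ HN); rewrite padic_pi_eq0.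
Qed.

Lemma padic_norm_ge0 x : 0 <= padic_norm x.
Proof. by have [u ->] := padic_piE x; case: padic_normP => // c N /ltW. Qed.

Lemma padic_norm_eq0 x : (padic_norm x == 0) = (x == 0).
Proof.
have [u ->] := padic_piE x; case: padic_normP => [_ ->|c N c0 /negbTE -> _].
  by rewrite !eqxx.
exact: gt_eqF.
Qed.

Lemma padic_normM x y : padic_norm (x * y) = padic_norm x * padic_norm y.
Proof.
have [->|x0] := eqVneq x 0; first by rewrite mul0r padic_norm0 mul0r.
have [->|y0] := eqVneq y 0; first by rewrite mulr0 padic_norm0 mulr0.
have [u xu] := padic_piE x; have [v yv] := padic_piE y.
move: x0 y0; rewrite {}xu {}yv.
case: padic_normP => [_ ->|c N c0 _ HN]; first by rewrite eqxx.
case: padic_normP => [_ ->|d M d0 _ HM]; first by rewrite eqxx.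
move=> _ _; rewrite -rmorphM.
apply: (@padic_norm_const _ _ (maxn N M)) => n.
rewrite geq_max => /andP[Nn Mn].
have -> : (u * v) n = u n * v n by [].
by rewrite padic_absM // HN // HM.
Qed.

Lemma padic_normN x : padic_norm (- x) = padic_norm x.
Proof.
have [u ->] := padic_piE x; rewrite -rmorphN.
have E n : abs ((- u) n) = abs (u n) := padic_absN p (u n).
case: (padic_normP u) => [H _|c N _ _ H].
  apply: padic_norm_pi => e /H[N HN]; exists N => n /HN.
  by rewrite E subr0 ger0_norm ?padic_abs_ge0.
by apply: (@padic_norm_const _ _ N) => n /H; rewrite E.
Qed.

Lemma padic_norm_lim u (e : rat) : 0 < e ->
  exists N : nat, forall n, (N <= n)%N ->
    `| abs (u n) - padic_norm (padic_pi u) | < e.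
Proof.
move=> e0; case: (padic_normP u) => [H _|c N _ _ H].
  have [N HN] := H _ e0; exists N => n /HN.
  by rewrite subr0 ger0_norm ?padic_abs_ge0.
by exists N => n /H ->; rewrite subrr normr0.
Qed.

Lemma padic_normD x y :
  padic_norm (x + y) <= Num.max (padic_norm x) (padic_norm y).
Proof.
have [u ->] := padic_piE x; have [v ->] := padic_piE y; rewrite -rmorphD.
apply/ler_addgt0Pl => e e0; have e20 : 0 < e / 2 by lra.
have [N HN] := padic_norm_lim u e20; have [M HM] := padic_norm_lim v e20.
have [K HK] := padic_norm_lim (u + v) e20.
pose n := maxn N (maxn M K).
have := HN n (leq_maxl _ _).
have := HM n (leq_trans (leq_maxl _ _) (leq_maxr _ _)).
have := HK n (leq_trans (leq_maxr _ _) (leq_maxr _ _)).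
have := padic_absD p_pr (u n) (v n).
have -> : (u + v) n = u n + v n by [].
rewrite le_max !ltr_norml.
set A := padic_norm (padic_pi u); set B := padic_norm (padic_pi v).
have : A <= Num.max A B by rewrite le_max lexx.
have : B <= Num.max A B by rewrite le_max lexx orbT.
by move=> ? ? /orP[]; lra.
Qed.

Lemma padic_norm1 : padic_norm 1 = 1.
Proof.
rewrite -(rmorph1 (@padic_pi p p_pr)).
by apply: (@padic_norm_const _ _ 0) => n _; apply: padic_abs1.
Qed.

Definition padic_dist x y : rat := padic_norm (x - y).

Lemma padic_distxx x : padic_dist x x = 0.
Proof. by rewrite /padic_dist subrr padic_norm0. Qed.

Lemma padic_dist_eq0 x y : padic_dist x y = 0 -> x = y.
Proof. by move/eqP; rewrite padic_norm_eq0 subr_eq0 => /eqP. Qed.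

Lemma padic_dist_sym x y : padic_dist x y = padic_dist y x.
Proof. by rewrite /padic_dist -padic_normN opprB. Qed.

Lemma padic_dist_triangle y x z :
  padic_dist x z <= padic_dist x y + padic_dist y z.
Proof.
rewrite /padic_dist -(subrK y x) -addrA; apply: le_trans (padic_normD _ _) _.
by rewrite subrK ge_max lerDl lerDr !padic_norm_ge0.
Qed.

HB.instance Definition _ := isMetric.Build rat (padic p_pr)
  padic_distxx padic_dist_eq0 padic_dist_sym padic_dist_triangle.
HB.instance Definition _ := isPointed.Build (padic p_pr) 0.

Lemma padic_const_cauchy (q : rat) : (fun=> q) \in padic_cauchy p_pr.
Proof.
by apply/padic_cauchyP => e e0; exists 0%N => m n; rewrite subrr padic_abs0.
Qed.

Definition rat_padic (q : rat) : padic p_pr :=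
  padic_pi (PadicSeq (padic_const_cauchy q)).

Lemma rat_padic_is_zmod : zmod_morphism rat_padic.
Proof.
by move=> a b; rewrite /rat_padic -rmorphB; congr padic_pi; apply: val_inj.
Qed.

Lemma rat_padic_is_monoid : monoid_morphism rat_padic.
Proof.
split; first by rewrite -(rmorph1 (@padic_pi p p_pr)); congr padic_pi; apply: val_inj.
by move=> a b; rewrite /rat_padic -rmorphM; congr padic_pi; apply: val_inj.
Qed.

HB.instance Definition _ :=
  GRing.isZmodMorphism.Build rat (padic p_pr) rat_padic rat_padic_is_zmod.
HB.instance Definition _ :=
  GRing.isMonoidMorphism.Build rat (padic p_pr) rat_padic rat_padic_is_monoid.

Lemma padic_norm_rat q : padic_norm (rat_padic q) = abs q.
Proof. exact: (@padic_norm_const _ _ 0). Qed.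

End PadicNorm.

Section PadicComplete.
Variables (p : nat) (p_pr : prime p).
Implicit Types x y : padic p_pr.

Lemma padic_ballE x (e : rat) : ball x e = [set y | padic_norm (x - y) < e].
Proof. by rewrite ballEmdist. Qed.

Lemma padic_dense x (e : rat) : 0 < e ->
  exists q : rat, padic_norm (x - rat_padic p_pr q) < e.
Proof.
move=> e0; have [u ->] := padic_piE x.
have e20 : 0 < e / 2 by lra.
have [N HN] := padic_cauchyP p_pr _ (valP u) _ e20.
exists (u N); rewrite -rmorphB; set w := _ - _.
have [M HM] := padic_norm_lim w e20.
have := HM _ (leq_maxl M N).
have : padic_abs p (w (maxn M N)) < e / 2 := HN _ _ (leq_maxr _ _) (leqnn N).
rewrite ltr_norml; lra.
Qed.

Lemma padic_pi_dist (u : padic_seq p_pr) (e : rat) : 0 < e -> exists N : nat,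
  forall n, (N <= n)%N -> padic_norm (padic_pi u - rat_padic p_pr (u n)) < e.
Proof.
move=> e0; have e20 : 0 < e / 2 by lra.
have [N HN] := padic_cauchyP p_pr _ (valP u) _ e20.
exists N => n Nn; rewrite -rmorphB; set w := _ - _.
have [M HM] := padic_norm_lim w e20.
have := HM _ (leq_maxl M N).
have : padic_abs p (w (maxn M N)) < e / 2 := HN _ _ (leq_maxr _ _) Nn.
rewrite ltr_norml; lra.
Qed.

Lemma padic_normD_lt x y (e : rat) :
  padic_norm x < e -> padic_norm y < e -> padic_norm (x + y) < e.
Proof.
by move=> xe ye; apply: le_lt_trans (padic_normD _ _) _; rewrite gt_max xe ye.
Qed.

Lemma padic_norm_distC x y : padic_norm (x - y) = padic_norm (y - x).
Proof. by rewrite -padic_normN opprB. Qed.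

Lemma invS_rat_lt (e : rat) : 0 < e -> exists N : nat,
  forall n, (N <= n)%N -> (n.+1%:R^-1 : rat) < e.
Proof.
move=> e0; exists (Num.truncn e^-1) => n Nn.
rewrite invf_plt ?posrE ?ltr0n //; apply: lt_le_trans (truncnS_gt _) _.
by rewrite ler_nat.
Qed.

Lemma padic_complete (F : set_system (padic p_pr)) :
  ProperFilter F -> cauchy F -> cvg F.
Proof.
move=> FF /(cauchyP F) cF.
have /choice[f Hf] (k : nat) : exists xq : padic p_pr * rat,
    F (ball xq.1 (k.+1%:R^-1 : rat)) /\
    padic_norm (xq.1 - rat_padic p_pr xq.2) < k.+1%:R^-1.
  have k0 : 0 < (k.+1%:R^-1 : rat) by rewrite invr_gt0 ltr0n.
  have [x Fx] := cF _ k0; have [q xq] := padic_dense x k0.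
  by exists (x, q).
pose q n := (f n).2.
have qP : q \in padic_cauchy p_pr.
  apply/padic_cauchyP => e /invS_rat_lt[N HN]; exists N => m n Nm Nn.
  have [Fm qm] := Hf m; have [Fn qn] := Hf n.
  have [z []] := filter_ex (filterI Fm Fn); rewrite !padic_ballE /= => zm zn.
  rewrite -(padic_norm_rat p_pr) rmorphB /=.
  have -> : rat_padic p_pr (q m) - rat_padic p_pr (q n) =
      (rat_padic p_pr (q m) - (f m).1) + ((f m).1 - z) +
      ((z - (f n).1) + ((f n).1 - rat_padic p_pr (q n))).
    by rewrite -!addrA !addKr.
  by apply: padic_normD_lt; apply: padic_normD_lt;
    rewrite 1?[padic_norm (z - _)]padic_norm_distC
      1?[padic_norm (rat_padic _ _ - _)]padic_norm_distC;
    (apply: lt_trans; [eassumption|exact: HN]).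
apply/cvg_ex; exists (padic_pi (PadicSeq qP)); apply/fcvg_ballP => e e0.
have [N HN] := invS_rat_lt e0; have [M HM] := padic_pi_dist (PadicSeq qP) e0.
pose k := maxn N M.
have [Fk qk] := Hf k; apply: filterS Fk => z; rewrite !padic_ballE /= => kz.
have -> : padic_pi (PadicSeq qP) - z =
    (padic_pi (PadicSeq qP) - rat_padic p_pr (q k)) +
    ((rat_padic p_pr (q k) - (f k).1) + ((f k).1 - z)).
  by rewrite -!addrA !addKr.
apply: padic_normD_lt; first exact: (HM k (leq_maxr _ _)).
apply: padic_normD_lt.
  by rewrite padic_norm_distC; apply: lt_trans qk (HN _ (leq_maxl _ _)).
exact: lt_trans kz (HN _ (leq_maxl _ _)).
Qed.

HB.instance Definition _ := Uniform_isComplete.Build (padic p_pr) padic_complete.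

Lemma padic_series_cvg (t : nat -> padic p_pr) :
  (forall e : rat, 0 < e -> exists N : nat, forall n, (N <= n)%N ->
     padic_norm (t n) < e) -> cvgn (series t).
Proof.
move=> t0; apply/cauchy_cvgP/cauchyP => e e0.
have [N HN] := t0 e e0; exists (series t N); exists N => // n /= Nn.
change (ball (series t N) e (series t n)); rewrite padic_ballE /=.
rewrite -(subnKC Nn); elim: (n - N)%N => [|k IH].
  by rewrite addn0 subrr padic_norm0.
rewrite addnS [series t _.+1]/series /= big_nat_recr //= opprD addrA.
by apply: padic_normD_lt; rewrite // padic_normN; apply: HN; apply: leq_addr.
Qed.

End PadicComplete.

Definition pochhammer (alpha : rat) (n : nat) : rat :=
  \prod_(i < n) (alpha + i%:R).

Definition phi p (p_pr : prime p) (alpha : rat) (z : padic p_pr) : padic p_pr :=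
  limn (series (fun n => rat_padic p_pr (pochhammer alpha n) * z ^+ n)).

Section PhiConvergence.
Variables (p : nat) (p_pr : prime p).

Lemma pochhammer_padic_abs (alpha : rat) (k n : nat) :
  ~~ (p %| `|denq alpha|)%N -> (p ^ k <= n)%N ->
  padic_abs p (pochhammer alpha n) <= p%:R ^- k.
Proof.
move=> pNd pkn; set r := numq alpha; set s := denq alpha.
have s0 : s != 0 by apply: denq_neq0.
have abs_s : padic_abs p s%:~R = 1.
  have Es : logn p `|s| = 0%N.
    by apply/eqP; rewrite -leqn0 leqNgt logn_gt0 mem_primes (negbTE pNd) !andbF.
  by rewrite (padic_absE p_pr s0) Es expr0 invr1.
have termE i : padic_abs p (alpha + i%:R) = padic_abs p (r + i%:Z * s)%:~R.
  rewrite rmorphD rmorphM /= numqE -mulrDl padic_absM // -/s abs_s mulr1.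
  by rewrite pmulrn.
have le1 i : padic_abs p (alpha + i%:R) <= 1.
  by rewrite termE padic_abs_int_le1.
have pk0 : (p ^ k)%:Z != 0 by rewrite -lt0n expn_gt0 prime_gt0.
have /coprimezP[[u v] /= uv] : coprimez s (p ^ k)%:Z.
  by rewrite coprimezE /= coprime_sym coprimeXl // prime_coprime.
pose i0 := ((- (r * u)) %% (p ^ k)%:Z)%Z.
have i0_ge0 : 0 <= i0 by apply: modz_ge0.
have i0_lt : i0 < (p ^ k)%:Z by apply: ltz_pmod; rewrite lt_def pk0.
have [i Ei] : exists i : nat, i0 = i%:Z by exists `|i0|%N; rewrite gez0_abs.
have ilt : (i < n)%N by apply: leq_trans pkn; rewrite -ltz_nat -Ei.
have pdvd : (p ^ k %| absz (r + i%:Z * s)%R)%N.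
  have : ((p ^ k)%:Z %| r + i%:Z * s)%Z.
    apply/dvdzP; exists (r * v - (- (r * u) %/ (p ^ k)%:Z)%Z * s).
    rewrite -Ei /i0; have := divz_eq (- (r * u)) (p ^ k)%:Z.
    set Q := (_ %/ _)%Z; set M := (_ %% _)%Z => E.
    have -> : M = - (r * u) - Q * (p ^ k)%:Z by rewrite {1}E addrAC subrr add0r.
    rewrite -{1}[r]mulr1 -uv; ring.
  by rewrite dvdzE.
rewrite /pochhammer.
have absprod (I : seq 'I_n) (P : pred 'I_n) :
    padic_abs p (\prod_(j <- I | P j) (alpha + j%:R)) <= 1.
  elim/big_rec: _ => [|j y _ yle]; first by rewrite padic_abs1.
  by rewrite padic_absM // mulr_ile1 ?padic_abs_ge0.
rewrite (bigD1 (Ordinal ilt)) //= padic_absM // termE -[leRHS]mulr1.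
by apply: ler_pM; rewrite ?padic_abs_ge0 // padic_abs_int_le.
Qed.

Lemma phi_cvg (alpha : rat) (z : padic p_pr) :
  ~~ (p %| `|denq alpha|)%N -> padic_norm z <= 1 ->
  cvgn (series (fun n => rat_padic p_pr (pochhammer alpha n) * z ^+ n)).
Proof.
move=> pNd z1; apply: padic_series_cvg => e e0.
have [k /(_ k (leqnn k)) ke] := invS_rat_lt e0; exists (p ^ k)%N => n kn.
have zn : padic_norm (z ^+ n) <= 1.
  elim: n {kn} => [|n IH]; first by rewrite expr0 padic_norm1.
  by rewrite exprS padic_normM mulr_ile1 ?padic_norm_ge0.
rewrite padic_normM padic_norm_rat.
apply: le_lt_trans (ler_piMr (padic_abs_ge0 _ _) zn) _.
apply: le_lt_trans (pochhammer_padic_abs pNd kn) _.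
apply: le_lt_trans ke; rewrite lef_pV2 ?posrE ?ltr0n //.
  by rewrite -natrX ler_nat ltn_expl // prime_gt1.
by rewrite exprn_gt0 // ltr0n prime_gt0.
Qed.

Lemma padic_norm_int_le1 (a : int) : padic_norm (a%:~R : padic p_pr) <= 1.
Proof. by rewrite -(rmorph_int (rat_padic p_pr)) padic_norm_rat padic_abs_int_le1. Qed.

End PhiConvergence.

Definition linear_form p (p_pr : prime p) m (alpha : 'I_m -> rat) (a : int)
    (l : 'I_m.+1 -> int) : padic p_pr :=
  (l ord0)%:~R +
  \sum_(j < m) (l (lift ord0 j))%:~R * phi (alpha j) a%:~R.

Definition Htilde (R : realType) (m : nat) (H : R) : int :=
  Num.floor (ln H / ln (ln H) *
    (1 + (5 / 4 * m.+1%:R + 6) / Num.sqrt (ln (ln H)))).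

(* Main.v *)
From HB Require Import structures.
Require Import Defs.
From mathcomp Require Import all_boot all_order all_algebra.
From mathcomp Require Import archimedean boolp classical_sets cardinality reals.
From mathcomp Require Import topology sequences exp.
From mathcomp Require Import lra ring zify.

(**
Write S_v for the v-th partial sum of the linear form L_p: a rational number
not depending on p. Let T be the linear functional on Q[x] sending the rising
factorial (x)_v = x (x + 1) ... (x + v - 1) to c_v = a^(-v) S_v. From
a c_(v+1) - c_v = sum_j l_j (alpha_j)_v one gets, for every polynomial P,

  a T(x P(x + 1)) = T(P) + sum_j l_j P(alpha_j),                            (1)

and iterating (1), if L_p = 0 then, p-adically,
T(P) = - sum_k a^k sum_j l_j (alpha_j)_k P(alpha_j + k).

Let U(x) = prod_j (x - alpha_j) and P_n(x) = U(x) U(x - 1) ... U(x - n + 1),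
which vanishes at alpha_j + k for k < n. If L_p = 0, the last formula gives
|T(P_n x^i)|_p <= |n!|_p^(m+1). On the other hand T(P_n x^i) becomes an integer
after multiplication by a geometric factor C^n, and its size is at most
h n!^m C^n.

Some T(P_n x^i) with i <= m is nonzero: otherwise (1) kills T on all multiples
of P_n, a Bezout relation between U(x - n + 1) and x U(x + 1) carries this over
to the multiples of P_(n-1), and finally T = 0, which forces all l_j to vanish.

If L_p = 0 for all primes y < p <= n not dividing s, the integer above is thus
divisible by the (m+1)-st power of the corresponding part of n!. A Mertens type
bound shows that the remaining part of n! is at most C^n y^(1.21 n), so that
n! <= h C^n y^(1.21 (m+1) n). With n = Htilde and y = exp(sqrt(log Htilde)) this
is false for large H; with y fixed it is false for large n.
*)

Set Implicit Arguments.
Unset Strict Implicit.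
Unset Printing Implicit Defensive.

Import Order.TTheory GRing.Theory Num.Theory.
Local Open Scope classical_set_scope.
Local Open Scope ring_scope.

(** * The part of [n!] made of small primes and primes dividing [s] *)

Section FactorialParts.
Local Open Scope nat_scope.

Lemma logn_fact_le p n : prime p -> p.-1 * logn p n`! <= n.
Proof.
move=> p_pr; rewrite logn_fact //.
(* The extra term [n %/ p ^ K] makes Legendre's sum telescope. *)
suff H K : p.-1 * (\sum_(1 <= k < K.+1) n %/ p ^ k) + n %/ p ^ K <= n.
  exact: leq_trans (leq_addr _ _) (H n).
elim: K => [|K IH]; first by rewrite big_geq // muln0 add0n expn0 divn1.
rewrite big_nat_recr //= mulnDr -addnA -mulSnr prednK ?prime_gt0 //.
apply: leq_trans IH; rewrite leq_add2l expnSr divnMA mulnC.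
exact: leq_trunc_div.
Qed.

Lemma logn_fact_ge p n : prime p -> n %/ p <= logn p n`!.
Proof.
move=> p_pr; rewrite logn_fact //; case: n => [|n]; first by rewrite div0n.
by rewrite big_ltn // expn1 leq_addr.
Qed.

Lemma logn_fact_leq p n : logn p n`! <= n.
Proof.
have [p_pr|pN] := boolP (prime p); last by rewrite lognE (negbTE pN).
apply: leq_trans (logn_fact_le n p_pr); apply: leq_pmull.
by have := prime_gt1 p_pr; lia.
Qed.

Lemma prod_range_le_fact a b M : 0 < a ->
  \prod_(0 <= p < M | a <= p <= b) p <= b`!.
Proof.
move=> a0; rewrite fact_prod.
have -> : \prod_(0 <= p < M | a <= p <= b) p =
          \prod_(0 <= p < minn M b.+1 | a <= p) p.
  rewrite [RHS](@big_nat_widen _ _ _ _ _ M) ?geq_minl //.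
  by rewrite big_nat_cond [RHS]big_nat_cond; apply: eq_bigl => p; lia.
apply: (@leq_trans (\prod_(0 <= p < b.+1 | a <= p) p)).
  have := geq_minr M b.+1; move: (minn M b.+1) => k kb.
  rewrite [leqRHS](@big_cat_nat _ _ _ k) //=.
  rewrite leq_pmulr // prodn_cond_gt0 // => p; lia.
rewrite big_mkcond big_ltn //= ifF ?mul1n; last by lia.
by rewrite big_seq [leqRHS]big_seq; apply: leq_prod => p; rewrite mem_index_iota; case: ifP; lia.
Qed.

Lemma fact_leq_exp n : n`! <= n ^ n.
Proof.
rewrite fact_prod; apply: (@leq_trans (\prod_(1 <= i < n.+1) n)).
  by rewrite big_nat [leqRHS]big_nat; apply: leq_prod => i; lia.
by rewrite prod_nat_const_nat subn1.
Qed.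

Lemma expn_prod (I : Type) (r : seq I) (P : pred I) (F : I -> nat) k :
  (\prod_(i <- r | P i) F i) ^ k = \prod_(i <- r | P i) F i ^ k.
Proof.
by apply: (big_morph (fun x => x ^ k)) => [x y|]; rewrite ?expnMn ?exp1n.
Qed.

(* For p >= 11 one has 10 p <= 11 (p - 1), so that v_p(n!) <= (11/10) n / p,
   while n / p is read off from v_p((10 y)!) + 1 >= 10 y / p: this is an upper
   bound for sum_(p <= y) log p / p with the constant 1.1 * 1.1 < 5/4. *)
Lemma fact_mid_part n y : 0 < y ->
  n`!`_[pred p | 11 <= p <= y] ^ 100 <= ((10 ^ 110) * y ^ 121) ^ n.
Proof.
move=> y0; set pi := [pred p | _]; set Z := (10 * y)`!.
pose M := n`! + Z.
have key : n`!`_pi ^ (100 * y) <= (Z * y`!) ^ (11 * n).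
  have Zle : \prod_(0 <= p < M.+1 | p \in pi) p ^ logn p Z <= Z.
    rewrite -widen_partn ?leq_addl //.
    by apply: dvdn_leq; rewrite ?fact_gt0 ?dvdn_part.
  have yle : \prod_(0 <= p < M.+1 | p \in pi) p <= y`!.
    by rewrite (eq_bigl (fun p => 11 <= p <= y)) ?prod_range_le_fact.
  apply: (@leq_trans ((\prod_(0 <= p < M.+1 | p \in pi) (p ^ logn p Z * p)) ^ (11 * n))).
    rewrite (widen_partn (m := M)) ?leq_addr // !expn_prod.
    apply: leq_prod => p; rewrite inE => /andP[p11 _].
    rewrite -expnSr -!expnM; apply: leq_pexp2l; first by lia.
    have [p_pr|pN] := boolP (prime p); last by rewrite lognE (negbTE pN).
    have A := logn_fact_le n p_pr; have B := logn_fact_ge (10 * y) p_pr.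
    rewrite -/Z in B; set v := logn p n`! in A *; set w := logn p Z in B *.
    have C : 10 * y <= p * w.+1.
      have := ltn_ceil (10 * y) (prime_gt0 p_pr).
      move/ltnW/leq_trans; apply; rewrite mulnC leq_mul2l ltnS B orbT //.
    have D : 10 * (p * v) <= 11 * n.
      have : 10 * p <= 11 * p.-1 by lia.
      move=> /(leq_mul (leqnn v)); nia.
    have E : (10 * y) * (10 * v) <= p * w.+1 * (10 * v) by rewrite leq_mul2r C orbT.
    have F : (10 * (p * v)) * w.+1 <= 11 * n * w.+1 by rewrite leq_mul2r D orbT.
    nia.
  have [->|n0] := posnP n; first by rewrite muln0 !expn0.
  by rewrite leq_exp2r ?muln_gt0 // big_split /= leq_mul.
have key2 : (Z * y`!) ^ (11 * n) <= (((10 ^ 110) * y ^ 121) ^ n) ^ y.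
  have [->|n0] := posnP n; first by rewrite muln0 !expn0 exp1n.
  apply: (@leq_trans (((10 * y) ^ (10 * y) * y ^ y) ^ (11 * n))).
    by rewrite leq_exp2r ?muln_gt0 // leq_mul ?fact_leq_exp.
  have RE u v : ((10 ^ u * y ^ v) ^ n) ^ y = 10 ^ (u * n * y) * y ^ (v * n * y).
    by rewrite !expnMn -!expnM !mulnA.
  rewrite RE !expnMn -!expnM -mulnA -expnD.
  have -> : 10 * y * (11 * n) = 110 * n * y by ring.
  by have -> : 110 * n * y + y * (11 * n) = 121 * n * y by ring.
by rewrite -(leq_exp2r _ _ y0) -expnM; apply: leq_trans key key2.
Qed.

(** A bad prime p <= s + 10 contributes at most p^n, since v_p(n!) <= n. A larger one cannot divide
    [s], so it is at most [y] and falls under [fact_mid_part]. *)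
Lemma fact_bad_part s : 0 < s -> exists2 C : nat, 0 < C & forall n y, 0 < y ->
  n`!`_[pred p | (y < p) && ~~ (p %| s)]^' ^ 100 <= C ^ n * y ^ (121 * n).
Proof.
move=> s0; exists ((s + 10)`! ^ 100 * 10 ^ 110).
  by rewrite muln_gt0 !expn_gt0 fact_gt0.
move=> n y y0; set bad := (_)^'%N.
pose mid := [pred p | 11 <= p <= y]; pose N := n`!.
have split : N`_bad <= (s + 10)`! ^ n * N`_mid.
  apply: (@leq_trans ((\prod_(0 <= p < N.+1 | 1 <= p <= s + 10) p) ^ n * N`_mid)).
    rewrite expn_prod /partn big_mkcond [X in X * _]big_mkcond [X in _ * X]big_mkcond /=.
    rewrite -big_split /=; apply: leq_prod => p _.
    have vle := logn_fact_leq p n.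
    case: p vle => [|p] vle; first by rewrite lognE /= ?expn0 ?if_same.
    have one : 1 <= (if 0 < p.+1 <= s + 10 then p.+1 ^ n else 1).
      by case: ifP; rewrite ?expn_gt0.
    case: ifP => [pbad|_]; last first.
      by rewrite muln_gt0 one; case: ifP; rewrite ?expn_gt0.
    have [ps|ps] := leqP p.+1 (s + 10).
      rewrite /=; apply: (@leq_trans (p.+1 ^ n)); first by rewrite leq_pexp2l.
      by apply: leq_pmulr; case: ifP; rewrite ?expn_gt0.
    rewrite /= mul1n ifT // inE; move: pbad.
    rewrite /bad inE /= negb_and negbK -leqNgt => /orP[|/(dvdn_leq s0)]; lia.
  rewrite leq_mul2r; apply/orP; right.
  have [->|n0] := posnP n; first by rewrite !expn0.
  by rewrite leq_exp2r // prod_range_le_fact.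
apply: (@leq_trans (((s + 10)`! ^ n * N`_mid) ^ 100)); first by rewrite leq_exp2r.
rewrite expnMn [leqRHS](_ : _ = ((s + 10)`! ^ n) ^ 100 * ((10 ^ 110) * y ^ 121) ^ n).
  by rewrite leq_mul2l fact_mid_part ?orbT.
have RE A B u k : (A ^ k * B) ^ n * y ^ (u * n) = (A ^ n) ^ k * (B * y ^ u) ^ n.
  by rewrite !expnMn -!expnM [n * k]mulnC mulnA.
exact: RE.
Qed.

End FactorialParts.

(** * Rising factorials as polynomials *)

Section RisingFactorial.

Definition rising (v : nat) : {poly rat} := \prod_(i < v) ('X + i%:R%:P).

Lemma rising0 : rising 0 = 1. Proof. exact: big_ord0. Qed.

Lemma risingSr v : rising v.+1 = rising v * ('X + v%:R%:P).
Proof. exact: big_ord_recr. Qed.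

Lemma risingSl v : rising v.+1 = 'X * (rising v \Po ('X + 1)).
Proof.
rewrite /rising big_ord_recl addr0; congr (_ * _).
rewrite (big_morph (comp_poly ('X + 1)) (fun p q => comp_polyM p q _) (comp_polyC 1 _)).
apply: eq_bigr => i _; rewrite comp_polyD comp_polyX comp_polyC -addrA.
by rewrite -[1 in RHS]/(1%:P) -polyCD nat1r.
Qed.

Lemma horner_rising v x : (rising v).[x] = pochhammer x v.
Proof.
by rewrite /rising /pochhammer horner_prod; apply: eq_bigr => i _; rewrite !hornerE.
Qed.

Lemma mulXsubC_rising b v :
  ('X - b%:P) * rising v = rising v.+1 - (v%:R + b) *: rising v.
Proof. by rewrite risingSr -mul_polyC polyCD; ring. Qed.

Lemma mulX_rising v : 'X * rising v = rising v.+1 - v%:R *: rising v.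
Proof. by rewrite -[v%:R]addr0 -mulXsubC_rising polyC0 subr0. Qed.

End RisingFactorial.

(** * The functional T and relation (1) *)

Section RisingFunctional.
Variable c : nat -> rat.

(** The value that T has to take at x^d (x)_v; the recursion is x (x)_v = (x)_(v+1) - v (x)_v. *)
Fixpoint rising_moment d v :=
  if d is d'.+1 then rising_moment d' v.+1 - v%:R * rising_moment d' v else c v.

(* The linear functional sending the rising factorial x (x + 1) ... (x + v - 1) to c v. *)
Definition rising_fun (P : {poly rat}) : rat :=
  \sum_(i < size P) P`_i * rising_moment i 0.

Local Notation T := rising_fun.

Lemma rising_fun_widen n (P : {poly rat}) : (size P <= n)%N ->
  T P = \sum_(i < n) P`_i * rising_moment i 0.
Proof.
move=> szP; rewrite /T (big_ord_widen n (fun i => P`_i * rising_moment i 0)) //.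
rewrite big_mkcond; apply: eq_bigr => i _; case: ltnP => // szi.
by rewrite nth_default // mul0r.
Qed.

Lemma rising_fun_is_scalar : scalar T.
Proof.
move=> k P Q; pose n := maxn (size (k *: P + Q)%R) (maxn (size P) (size Q)).
rewrite !(@rising_fun_widen n) ?leq_max ?leqnn ?orbT //.
rewrite mulr_sumr -big_split; apply: eq_bigr => i _ /=.
by rewrite coefD coefZ; ring.
Qed.

HB.instance Definition _ := GRing.isLinear.Build rat {poly rat} rat _ T
  rising_fun_is_scalar.

Lemma rising_funXnM d v : T ('X^d * rising v) = rising_moment d v.
Proof.
elim: v d => [|v IH] d.
  rewrite rising0 mulr1 (@rising_fun_widen d.+1) ?size_polyXn //.
  rewrite big_ord_recr /= coefXn eqxx mul1r big1 ?add0r // => i _.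
  by rewrite coefXn ltn_eqF // mul0r.
have -> : 'X^d * rising v.+1 = 'X^(d.+1) * rising v + v%:R *: ('X^d * rising v).
  by rewrite risingSr exprSr -mul_polyC; ring.
by rewrite linearD linearZ /= !IH /= addrNK.
Qed.

Lemma rising_fun_rising v : T (rising v) = c v.
Proof. by have := rising_funXnM 0 v; rewrite mul1r. Qed.

Lemma rising_funXsubCM Q b v : T (('X - b%:P) * Q * rising v) =
  T (Q * rising v.+1) - (v%:R + b) * T (Q * rising v).
Proof.
rewrite mulrAC mulXsubC_rising mulrBl linearB /= ![_ * Q]mulrC.
by rewrite -scalerAr linearZ.
Qed.

Lemma rising_funXM Q v : T (Q * 'X * rising v) =
  T (Q * rising v.+1) - v%:R * T (Q * rising v).
Proof.
by rewrite -mulrA mulX_rising mulrBr linearB /= -scalerAr linearZ.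
Qed.

Section Shift.
Variables (a : rat) (m : nat) (alpha : 'I_m -> rat) (l : 'I_m -> rat).
Hypothesis c_rec : forall v,
  a * c v.+1 = c v + \sum_(j < m) l j * pochhammer (alpha j) v.

Definition eval_form (P : {poly rat}) : rat := \sum_(j < m) l j * P.[alpha j].

(** Relation (1). On rising factorials it is [c_rec], because x (x + 1)_v = (x)_(v+1); linearity
    does the rest. *)
Lemma rising_fun_shift P :
  a * T ('X * (P \Po ('X + 1))) = T P + eval_form P.
Proof.
(* Carrying [rising v] along lets the factor ['X] of a Horner step be absorbed by passing from [v]
   to [v.+1]. *)
suff H v : a * T ('X * ((P * rising v) \Po ('X + 1))) =
    T (P * rising v) + eval_form (P * rising v).
  by have := H 0%N; rewrite rising0 mulr1.
elim/poly_ind: P v => [|P k IH] v.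
  rewrite mul0r comp_poly0 mulr0 !raddf0 mulr0 add0r /eval_form big1 // => j _.
  by rewrite horner0 mulr0.
have E : (P * 'X + k%:P) * rising v =
    P * rising v.+1 - v%:R *: (P * rising v) + k *: rising v.
  rewrite mulrDl mul_polyC; congr (_ + _).
  by rewrite -mulrA mulX_rising mulrBr -scalerAr.
have TE A B D x y : T (A - x *: B + y *: D) = T A - x * T B + y * T D.
  by rewrite linearD linearB !linearZ.
rewrite E comp_polyD comp_polyB !comp_polyZ mulrDr mulrBr -!scalerAr -risingSl.
rewrite !TE !rising_fun_rising.
have -> : forall X Y Z x y, a * (X - x * Y + y * Z) = a * X - x * (a * Y) + y * (a * Z).
  by move=> *; ring.
rewrite !IH c_rec.
have -> : \sum_(j < m) l j * pochhammer (alpha j) v = eval_form (rising v).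
  by apply: eq_bigr => j _; rewrite horner_rising.
suff -> : eval_form (P * rising v.+1 - v%:R *: (P * rising v) + k *: rising v) =
   eval_form (P * rising v.+1) - v%:R * eval_form (P * rising v) +
   k * eval_form (rising v) by ring.
rewrite /eval_form !mulr_sumr -sumrB -big_split; apply: eq_bigr => j _ /=.
by rewrite !(hornerD, hornerN, hornerZ, hornerM); ring.
Qed.

(** Closed form of the [K]-th iterate of P(x) -> x P(x + 1). *)
Definition shifted K (P : {poly rat}) := rising K * (P \Po ('X + K%:R%:P)).

Lemma shiftedS K P : shifted K.+1 P = 'X * (shifted K P \Po ('X + 1)).
Proof.
rewrite /shifted comp_polyM mulrA -risingSl -comp_polyA.
rewrite comp_polyD comp_polyX comp_polyC -addrA.
by rewrite -[1 in RHS]/(1%:P) -polyCD nat1r.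
Qed.

Lemma rising_fun_unroll K P :
  T P = a ^+ K * T (shifted K P) -
    \sum_(k < K) a ^+ k * eval_form (shifted k P).
Proof.
elim: K => [|K IH].
  by rewrite big_ord0 subr0 mul1r /shifted rising0 mul1r addr0 comp_polyXr.
rewrite IH big_ord_recr /= shiftedS exprSr -mulrA rising_fun_shift; ring.
Qed.

Lemma eval_form_shifted k P :
  eval_form (shifted k P) =
  \sum_(j < m) l j * (pochhammer (alpha j) k * P.[alpha j + k%:R]).
Proof.
apply: eq_bigr => j _; rewrite /shifted hornerM horner_rising horner_comp.
by rewrite !hornerE.
Qed.

End Shift.
End RisingFunctional.

(** * The polynomials U and P_n *)

Section PadePolynomial.
Variables (m : nat) (alpha : 'I_m -> rat).

(** This is U translated by [x]; thus [root_poly (-1)] is U(X + 1). *)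
Definition root_poly (x : rat) : {poly rat} :=
  \prod_(j < m) ('X - (alpha j + x)%:P).

Definition pade_poly (n : nat) : {poly rat} := \prod_(k < n) root_poly k%:R.

Lemma root_poly_shift x : root_poly x \Po ('X + 1) = root_poly (x - 1).
Proof.
rewrite /root_poly (big_morph (comp_poly ('X + 1)) (fun p q => comp_polyM p q _) (comp_polyC 1 _)).
apply: eq_bigr => j _; rewrite comp_polyB comp_polyX comp_polyC.
rewrite addrA polyCB polyC1; ring.
Qed.

Lemma pade_polyS n : pade_poly n.+1 = pade_poly n * root_poly n%:R.
Proof. exact: big_ord_recr. Qed.

Lemma pade_poly_shift n :
  pade_poly n.+1 \Po ('X + 1) = root_poly (-1) * pade_poly n.
Proof.
rewrite /pade_poly (big_morph (comp_poly ('X + 1)) (fun p q => comp_polyM p q _) (comp_polyC 1 _)).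
rewrite big_ord_recl root_poly_shift sub0r; congr (_ * _).
by apply: eq_bigr => k _; rewrite root_poly_shift -natr1 addrK.
Qed.

Lemma horner_root_poly x y : (root_poly x).[y] = \prod_(j < m) (y - alpha j - x).
Proof.
by rewrite horner_prod; apply: eq_bigr => j _; rewrite hornerXsubC opprD addrA.
Qed.

Lemma horner_pade_poly n y :
  (pade_poly n).[y] = \prod_(j < m) \prod_(k < n) (y - alpha j - k%:R).
Proof.
rewrite horner_prod exchange_big /=.
by apply: eq_bigr => k _; rewrite horner_root_poly.
Qed.

Lemma horner_pade_poly_small n j k : (k < n)%N ->
  (pade_poly n).[alpha j + k%:R] = 0.
Proof.
move=> kn; rewrite horner_pade_poly; apply/eqP/prodf_eq0; exists j => //.
by apply/prodf_eq0; exists (Ordinal kn) => //=; apply/eqP; ring.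
Qed.

End PadePolynomial.

(** * Nonvanishing of some T(P_n x^i) with i <= m *)

Section NonVanishing.
Variables (c : nat -> rat) (a : rat) (m : nat).
Variables (alpha : 'I_m -> rat) (l : 'I_m -> rat).
Hypothesis c_rec : forall v,
  a * c v.+1 = c v + \sum_(j < m) l j * pochhammer (alpha j) v.
Hypothesis a_neq0 : a != 0.
Hypothesis alpha_nonpos : forall (j : 'I_m) (k : nat), alpha j != - k%:R.
Hypothesis alpha_diff :
  forall i j : 'I_m, i != j -> alpha i - alpha j \isn't a Num.int.

Local Notation T := (rising_fun c).
Local Notation U := (root_poly alpha).
Local Notation P := (pade_poly alpha).

(** Relation (1) for P_(n+1) G: the boundary terms drop out because P_(n+1) is zero at every
    alpha_j. *)
Lemma rising_fun_pade_shift n G :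
  a * T (P n * ('X * U (-1) * (G \Po ('X + 1)))) = T (P n.+1 * G).
Proof.
have := rising_fun_shift c_rec (P n.+1 * G).
rewrite comp_polyM pade_poly_shift [eval_form _ _ _]big1 => [|j _].
  by rewrite addr0 => <-; congr (a * T _); ring.
have := @horner_pade_poly_small _ alpha n.+1 j 0 isT.
by rewrite addr0 hornerM => ->; rewrite mul0r mulr0.
Qed.

(* The relation [T (P n (U(x - n) G(x) - a x U(x + 1) G(x + 1))) = 0] has
   degree [m + 1 + deg G], so it eliminates every degree above [m]. *)
Lemma rising_fun_pade_eq0 n : (forall i, (i <= m)%N -> T (P n * 'X^i) = 0) ->
  forall F, T (P n * F) = 0.
Proof.
move=> T0 F; have [k] := ubnP (size F); elim: k F => // k IH F /ltnSE szF.
have [szFm|szFm] := leqP (size F) m.+1.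
  rewrite -[F]coefK poly_def mulr_sumr raddf_sum big1 // => i _ /=.
  rewrite -scalerAr linearZ /= T0 ?mulr0 // -ltnS.
  exact: leq_trans (ltn_ord i) szFm.
(* With this [d], [M] has the size of [F], while U(x - n) x^d falls one degree short. *)
pose d := (size F - m.+2)%N; pose M := 'X * U (-1) * ('X + 1) ^+ d.
have sU x : size (U x) = m.+1.
  by rewrite size_prod_XsubC /index_enum -enumT size_enum_ord.
have mU x : U x \is monic by apply: monic_prod_XsubC.
have mX1 : ('X + 1 : {poly rat}) ^+ d \is monic by rewrite monic_exp // monicXaddC.
have mXU : 'X * U (-1) \is monic by rewrite monicMl ?monicX.
have mM : M \is monic by rewrite /M monicMl.
have sM : size M = size F.
  rewrite size_monicM ?monic_neq0 // size_monicM ?monicX ?monic_neq0 //.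
  have -> : 'X + 1 = 'X - (-1)%:P :> {poly rat} by rewrite polyCN opprK.
  by rewrite size_polyX sU size_exp_XsubC /d; lia.
pose E := U n%:R * 'X^d - a *: M.
have TE : T (P n * E) = 0.
  have ME : M = 'X * U (-1) * ('X^d \Po ('X + 1)) by rewrite comp_Xn_poly.
  rewrite mulrBr linearB /= -scalerAr linearZ /= ME.
  by rewrite rising_fun_pade_shift pade_polyS mulrA subrr.
(* [E] has the degree of [F] and leading coefficient [- a], so the leading term of [F] cancels. *)
pose F' := F + (lead_coef F / a) *: E.
have -> : F = F' - (lead_coef F / a) *: E by rewrite /F' addrK.
rewrite mulrBr linearB /= -scalerAr linearZ /= TE mulr0 subr0.
apply: IH; apply: leq_trans szF; rewrite -[ltnRHS]prednK; last by lia.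
rewrite ltnS; apply/leq_sizeP => j; rewrite leq_eqVlt => /orP[/eqP <-|szj].
  have UX : (U n%:R * 'X^d)`_(size F).-1 = 0.
    by rewrite coefMXn ifF ?nth_default ?sU // /d; lia.
  rewrite coefD coefZ coefB coefZ UX -{2}sM -/(lead_coef M) (monicP mM).
  by rewrite sub0r mulr1 mulrN divfK // addrN.
have jF : (size F <= j)%N by lia.
rewrite coefD coefZ coefB coefZ [F`_j]nth_default // [M`_j]nth_default ?sM //.
rewrite coefMXn ifF ?nth_default ?sU ?mulr0 ?subr0 ?addr0 ?mulr0 //; rewrite /d; lia.
Qed.

(** A common root means alpha_j + n = 0 or alpha_j + n = alpha_i - 1. The first makes alpha_j a
    non-positive integer; the second makes alpha_j - alpha_i an integer, or n + 1 = 0 when i = j. *)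
Lemma coprime_root_poly n : coprimep (U n%:R) ('X * U (-1)).
Proof.
rewrite /root_poly coprimep_sym.
apply: (big_ind (fun q => coprimep ('X * U (-1)) q)) => [|p q hp hq|j _].
- exact: coprimep1.
- by rewrite coprimepMr hp.
rewrite coprimep_XsubC rootM negb_or rootX; apply/andP; split.
  by rewrite addr_eq0.
rewrite /root horner_root_poly; apply/prodf_neq0 => i _.
have [<-|ij] := eqVneq j i.
  have -> : alpha j + n%:R - alpha j - -1 = n.+1%:R by rewrite -natr1; ring.
  by rewrite pnatr_eq0.
apply: contraNneq (alpha_diff ij) => /eqP.
have -> : alpha j + n%:R - alpha i - -1 = (alpha j - alpha i) + n.+1%:R.
  by rewrite -natr1; ring.
rewrite addr_eq0 => /eqP ->; rewrite rpredN; exact: rpred_nat.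
Qed.

(** Bezout splits F into a multiple of U(x - n), which completes P_n to P_(n+1), and a multiple of x
    U(x + 1), where [rising_fun_pade_shift] leads back to P_(n+1). *)
Lemma rising_fun_descent n : (forall F, T (P n.+1 * F) = 0) ->
  forall F, T (P n * F) = 0.
Proof.
move=> T0 F; have /Bezout_eq1_coprimepP[[u v] /= uv] := coprime_root_poly n.
have -> : P n * F = P n.+1 * (u * F) +
    P n * ('X * U (-1) * ((v * F \Po ('X - 1)) \Po ('X + 1))).
  rewrite pade_polyS -comp_polyA comp_polyB comp_polyX (comp_polyC 1) addrK comp_polyXr.
  rewrite -[F in LHS]mul1r -uv; ring.
rewrite linearD /= T0 add0r; apply: (mulfI a_neq0).
by rewrite rising_fun_pade_shift T0 mulr0.
Qed.

(** If all these values vanished, descent to P_0 = 1 would give T = 0; then c_0 = T(1) = 0, and (1)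
    reads sum_j l_j P(alpha_j) = 0 for every P. *)
Lemma rising_fun_neq0 n : (c 0 != 0) || [exists j, l j != 0] ->
  exists2 i, (i <= m)%N & T (P n * 'X^i) != 0.
Proof.
move=> cl; have [/existsP[i Ti]|] := boolP [exists i : 'I_m.+1, T (P n * 'X^i) != 0].
  by exists i => //; rewrite -ltnS.
rewrite negb_exists => /forallP nex.
have T0 i : (i <= m)%N -> T (P n * 'X^i) = 0.
  by move=> im; apply/eqP/negPn; apply: (nex (Ordinal (im : (i < m.+1)%N))).
have {T0} T0 := rising_fun_pade_eq0 T0.
have {}T0 F : T F = 0.
  rewrite -[F]mul1r; have <- : P 0 = 1 by exact: big_ord0.
  elim: n T0 F {nex} => [|k IH] T0 F //.
  by apply: IH; apply: rising_fun_descent.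
move: cl; rewrite -rising_fun_rising T0 eqxx => /existsP[j /negP lj]; case: lj.
(* This polynomial vanishes at every alpha_i except alpha_j, so it isolates l_j. *)
have := rising_fun_shift c_rec (\prod_(i < m | i != j) ('X - (alpha i)%:P)).
rewrite !T0 mulr0 add0r /eval_form (bigD1 j) //= [X in _ + X]big1 => [|i ij].
  rewrite addr0 => /esym/eqP; rewrite mulf_eq0 => /orP[//|].
  rewrite horner_prod => /prodf_eq0[i ij]; rewrite hornerXsubC subr_eq0 => /eqP E.
  by move: (alpha_diff ij); rewrite E subrr rpred0.
by rewrite (bigD1 i) //= hornerM hornerXsubC subrr mul0r mulr0.
Qed.

End NonVanishing.

(** * Denominators of the values of T *)

Section Integrality.
Variables (c : nat -> rat) (a s : rat).
Hypotheses (a_int : a \is a Num.int) (s_int : s \is a Num.int).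
Hypothesis c_int : forall v, (a * s) ^+ v * c v \is a Num.int.

(** Removing a factor x - b may raise v by one, at the cost of a s, and takes one more s for the
    denominator of b. *)
Lemma rising_fun_int (rs : seq rat) v :
  (forall b, b \in rs -> s * b \is a Num.int) ->
  a ^+ (size rs + v) * s ^+ ((size rs).*2 + v) *
    rising_fun c (\prod_(b <- rs) ('X - b%:P) * rising v) \is a Num.int.
Proof.
elim: rs v => [|b rs IH] v rs_int.
  by rewrite big_nil mul1r rising_fun_rising -exprMn.
have {}IH v' := IH v' (fun x xrs => rs_int x (@mem_behead _ (b :: rs) x xrs)).
have sb : s * b \is a Num.int by rewrite rs_int ?mem_head.
rewrite big_cons rising_funXsubCM; set A := rising_fun _ _; set B := rising_fun _ _.
have -> : a ^+ (size (b :: rs) + v) * s ^+ ((size (b :: rs)).*2 + v) *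
    (A - (v%:R + b) * B) =
  s * (a ^+ (size rs + v.+1) * s ^+ ((size rs).*2 + v.+1) * A) -
  a * s * (v%:R * s + s * b) * (a ^+ (size rs + v) * s ^+ ((size rs).*2 + v) * B).
  by rewrite /= doubleS !addSn !addnS !exprS; ring.
apply: rpredB; first by apply: rpredM s_int (IH v.+1).
apply: rpredM (IH v); apply: rpredM; first exact: rpredM.
by apply: rpredD => //; apply: rpredM => //; apply: rpred_nat.
Qed.

End Integrality.

(** * Archimedean size of the values of T *)

Section Size.
Variables (c : nat -> rat) (K : rat) (X : nat).
Hypothesis K_ge0 : 0 <= K.
Hypothesis c_le : forall v, (v <= X)%N -> `|c v| <= K * v`!%:R.

(* X^_v is the solution of f(v + 1) = (X - v) f(v) and so absorbs the
   recursion T ((x - b) Q rising v) = T (Q rising v.+1) - (v + b) T (Q rising v). *)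
Lemma rising_fun_le (rs : seq rat) v : (size rs + v <= X)%N ->
  `|rising_fun c (\prod_(b <- rs) ('X - b%:P) * rising v)| <=
  K * \prod_(b <- rs) (X%:R + `|b|) * (X ^_ v)%:R.
Proof.
elim: rs v => [|b rs IH] v /= szX.
  rewrite !big_nil mul1r mulr1 rising_fun_rising; apply: le_trans (c_le szX) _.
  by apply: ler_wpM2l => //; rewrite ler_nat -bin_ffact leq_pmull ?bin_gt0.
rewrite !big_cons rising_funXsubCM.
have H1 := IH v.+1 ltac:(lia); have H2 := IH v ltac:(lia).
set A := rising_fun _ _ in H1 *; set B := rising_fun _ _ in H2 *.
apply: le_trans (ler_normB _ _) _; rewrite normrM.
have H3 : `|v%:R + b| <= v%:R + `|b|.
  by apply: le_trans (ler_normD _ _) _; rewrite normr_nat.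
have H4 : `|v%:R + b| * `|B| <= (v%:R + `|b|) *
    (K * \prod_(j <- rs) (X%:R + `|j|) * (X ^_ v)%:R) by apply: ler_pM.
apply: le_trans (lerD H1 H4) _; rewrite le_eqVlt; apply/orP; left; apply/eqP.
rewrite ffactnSr natrM natrB; last by lia.
by ring.
Qed.

End Size.

(** * The partial sums S_v and the coefficients c_v *)

Section PartialForm.
Variables (m : nat) (alpha : 'I_m -> rat) (a : int) (l : 'I_m.+1 -> int).

Definition partial_form (v : nat) : rat :=
  (l ord0)%:~R + \sum_(j < m) (l (lift ord0 j))%:~R *
    \sum_(k < v) pochhammer (alpha j) k * a%:~R ^+ k.

Definition form_coef (v : nat) : rat := a%:~R ^- v * partial_form v.

Lemma form_coef0 : form_coef 0 = (l ord0)%:~R.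
Proof.
rewrite /form_coef /partial_form big1 ?addr0 ?expr0 ?invr1 ?mul1r // => j _.
by rewrite big_ord0 mulr0.
Qed.

Lemma form_coef_rec v : a != 0 -> a%:~R * form_coef v.+1 = form_coef v +
  \sum_(j < m) (l (lift ord0 j))%:~R * pochhammer (alpha j) v.
Proof.
move=> a0; have a0' : a%:~R != 0 :> rat by rewrite intr_eq0.
rewrite /form_coef; have -> : partial_form v.+1 = partial_form v + a%:~R ^+ v *
    \sum_(j < m) (l (lift ord0 j))%:~R * pochhammer (alpha j) v.
  rewrite /partial_form -addrA; congr (_ + _).
  rewrite mulr_sumr -big_split; apply: eq_bigr => j _ /=.
  by rewrite big_ord_recr /=; ring.
have av0 := expf_neq0 v a0'.
by rewrite exprS; field; rewrite av0 a0'.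
Qed.

End PartialForm.

(** * p-adic estimates and the consequence of L_p = 0 *)

Section PadicBounds.
Variables (p : nat) (p_pr : prime p).
Local Notation abs := (padic_abs p).

Lemma padic_abs_nat_le1 k : abs k%:R <= 1.
Proof. exact: (padic_abs_int_le1 p_pr k). Qed.

Lemma padic_abs_sum_le (I : Type) (r : seq I) (Q : pred I) (F : I -> rat) e :
  0 <= e -> (forall i, Q i -> abs (F i) <= e) ->
  abs (\sum_(i <- r | Q i) F i) <= e.
Proof.
move=> e0 Fe; apply: (big_ind (fun x => abs x <= e)) => [|x y xe ye|]; last exact: Fe.
  by rewrite padic_abs0.
by apply: le_trans (padic_absD p_pr _ _) _; rewrite ge_max xe.
Qed.

Lemma padic_abs_exp x k : abs (x ^+ k) = abs x ^+ k.
Proof.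
by elim: k => [|k IH]; rewrite ?expr0 ?padic_abs1 // !exprS padic_absM // IH.
Qed.

Lemma padic_abs_prod (I : Type) (r : seq I) (Q : pred I) (F : I -> rat) :
  abs (\prod_(i <- r | Q i) F i) = \prod_(i <- r | Q i) abs (F i).
Proof. by apply: big_morph; [exact: padic_absM|exact: padic_abs1]. Qed.

Lemma padic_abs_prodB_le n (x y : nat -> rat) e : 0 <= e ->
  (forall k, abs (x k) <= 1) -> (forall k, abs (y k) <= 1) ->
  (forall k, abs (x k - y k) <= e) ->
  abs (\prod_(k < n) x k - \prod_(k < n) y k) <= e.
Proof.
move=> e0 x1 y1 xy; elim: n => [|n IH].
  by rewrite !big_ord0 subrr padic_abs0.
rewrite !big_ord_recr /=; set X := \prod_(_ < _) x _ in IH *.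
set Y := \prod_(_ < _) y _ in IH *.
have Y1 : abs Y <= 1.
  rewrite padic_abs_prod; apply: prodr_ile1 => i; rewrite padic_abs_ge0 //=.
have -> : X * x n - Y * y n = (X - Y) * x n + Y * (x n - y n) by ring.
apply: le_trans (padic_absD p_pr _ _) _; rewrite ge_max !padic_absM //.
by rewrite -[e]mulr1 ler_pM ?padic_abs_ge0 //= mulrC ler_pM ?padic_abs_ge0.
Qed.

Lemma prodrB_nat (b n : nat) :
  \prod_(k < n) (b%:R - k%:R) = (b ^_ n)%:R :> rat.
Proof.
elim: n => [|n IH]; first by rewrite big_ord0 ffactn0.
rewrite big_ord_recr /= IH ffactnSr natrM.
have [bn|bn] := leqP n b; first by rewrite natrB.
by rewrite ffact_small // !mul0r.
Qed.

Variables (s : nat) (p_s : ~~ (p %| s)%N).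

Let s_neq0 : (s%:R : rat) != 0.
Proof. by rewrite pnatr_eq0; apply: contraNneq p_s => ->. Qed.

Lemma padic_abs_unit : abs s%:R = 1.
Proof.
have s0 : s%:Z != 0 by move: s_neq0; rewrite pnatr_eq0.
have := padic_absE p_pr s0.
have -> : logn p `|s%:Z| = 0%N.
  by apply/eqP; rewrite -leqn0 leqNgt logn_gt0 mem_primes (negbTE p_s) !andbF.
by rewrite expr0 invr1.
Qed.

Lemma padic_abs_frac_le1 (r : int) : abs (r%:~R / s%:R) <= 1.
Proof.
by rewrite padic_absM // padic_absV // padic_abs_unit invr1 mulr1 padic_abs_int_le1.
Qed.

(** [s] is invertible modulo p^M, and [b] is the residue of r / s. *)
Lemma padic_frac_approx (r : int) M :
  exists b : nat, abs (r%:~R / s%:R - b%:R) <= p%:R ^- M.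
Proof.
have pk0 : (p ^ M)%:Z != 0 by rewrite -lt0n expn_gt0 prime_gt0.
have /coprimezP[[u v] /= uv] : coprimez s%:Z (p ^ M)%:Z.
  by rewrite coprimezE /= coprime_sym coprimeXl // prime_coprime.
pose b := ((r * u) %% (p ^ M)%:Z)%Z.
exists `|b|%N.
have bE : (`|b|%N)%:R = b%:~R :> rat.
  by rewrite pmulrn gez0_abs // modz_ge0.
rewrite bE; set x := _ - _.
have -> : x = (r - s%:Z * b)%:~R / s%:R.
  by rewrite /x intrB intrM -pmulrn mulrBl [_ * b%:~R]mulrC mulfK.
rewrite padic_absM // padic_absV // padic_abs_unit invr1 mulr1.
apply: padic_abs_int_le => //.
have : ((p ^ M)%:Z %| r - s%:Z * b)%Z.
  apply/dvdzP; exists (r * v + s%:Z * ((r * u) %/ (p ^ M)%:Z)%Z).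
  have := divz_eq (r * u) (p ^ M)%:Z; rewrite -/b.
  set Q := (_ %/ _)%Z => E.
  have -> : b = r * u - Q * (p ^ M)%:Z by rewrite {1}E addrAC subrr add0r.
  by rewrite -{1}[r]mulr1 -uv; ring.
by rewrite dvdzE.
Qed.

Lemma padic_abs_fact n : abs n`!%:R = p%:R ^- logn p n`!.
Proof.
have n0 : (n`!%:Z : int) != 0 by rewrite -lt0n fact_gt0.
by rewrite pmulrn (padic_absE p_pr n0).
Qed.

(** Replacing r / s by a p-adically close natural number turns the product into [n!] times a
    binomial coefficient. *)
Lemma padic_abs_falling (r : int) n :
  abs (\prod_(k < n) (r%:~R / s%:R - k%:R)) <= abs n`!%:R.
Proof.
have [b bP] := padic_frac_approx r (logn p n`!).
rewrite -padic_abs_fact in bP; set beta := _ / _ in bP *.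
rewrite -[X in abs X](subrK (\prod_(k < n) (b%:R - k%:R))).
apply: le_trans (padic_absD p_pr _ _) _; rewrite ge_max; apply/andP; split.
  have subn1 x k : abs x <= 1 -> abs (x - k%:R) <= 1.
    move=> x1; apply: le_trans (padic_absD p_pr _ _) _.
    by rewrite ge_max x1 padic_absN padic_abs_nat_le1.
  apply: (@padic_abs_prodB_le n (fun k => beta - k%:R) (fun k => b%:R - k%:R)).
  - exact: padic_abs_ge0.
  - by move=> k; apply: subn1; apply: padic_abs_frac_le1.
  - by move=> k; apply: subn1; apply: padic_abs_nat_le1.
  by move=> k; rewrite opprB addrA subrK.
rewrite prodrB_nat -bin_ffact natrM padic_absM //.
by rewrite ler_piMl ?padic_abs_ge0 ?padic_abs_nat_le1.
Qed.

Lemma padic_abs_pochhammer (r : int) n k : (n <= k)%N ->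
  abs (pochhammer (r%:~R / s%:R) k) <= abs n`!%:R.
Proof.
move=> nk; have -> : abs (pochhammer (r%:~R / s%:R) k) =
    abs (\prod_(i < k) ((- r)%:~R / s%:R - i%:R)).
  rewrite /pochhammer !padic_abs_prod; apply: eq_bigr => i _.
  by rewrite -padic_absN opprD rmorphN /= mulNr.
apply: le_trans (padic_abs_falling (- r) k) _.
rewrite -(bin_fact nk) !natrM !padic_absM //.
rewrite mulrCA ler_piMr ?padic_abs_ge0 //.
by rewrite mulr_ile1 ?padic_abs_ge0 ?padic_abs_nat_le1.
Qed.

Definition padic_vanishing (u : nat -> rat) :=
  forall e : rat, 0 < e -> exists N : nat, forall k, (N <= k)%N -> abs (u k) < e.

Lemma padic_vanishingD u w : padic_vanishing u -> padic_vanishing w ->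
  padic_vanishing (fun k => u k + w k).
Proof.
move=> hu hw e e0; have [N HN] := hu e e0; have [M HM] := hw e e0.
exists (maxn N M) => k; rewrite geq_max => /andP[Nk Mk].
by apply: padic_absD_lt => //; [apply: HN|apply: HM].
Qed.

Lemma padic_vanishingZ x u : padic_vanishing u ->
  padic_vanishing (fun k => x * u k).
Proof.
move=> hu e e0; have x1 : 0 < abs x + 1 by have := padic_abs_ge0 p x; lra.
have [N HN] := hu _ (divr_gt0 e0 x1); exists N => k /HN.
rewrite padic_absM // ltr_pdivlMr // mulrDr mulr1 mulrC.
by have := padic_abs_ge0 p (u k); lra.
Qed.

Lemma padic_vanishing_shift v u : padic_vanishing u ->
  padic_vanishing (fun k => u (k + v)%N).
Proof.
move=> hu e /hu[N HN]; exists N => k Nk; apply: HN; exact: leq_trans (leq_addr _ _).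
Qed.

Section FormBound.
Variables (m : nat) (alpha : 'I_m -> rat) (a : int) (l : 'I_m.+1 -> int).
Hypothesis a_neq0 : a != 0.
Hypothesis alpha_frac : forall j, exists r : int, alpha j = r%:~R / s%:R.
Local Notation S := (partial_form alpha a l).
Local Notation T := (rising_fun (form_coef alpha a l)).
Hypothesis S_vanishing : padic_vanishing S.

Let a0 : a%:~R != 0 :> rat. Proof. by rewrite intr_eq0. Qed.

(** This is the remainder of the iterated relation (1). In the rising basis it reduces to a^k
    c_(k+v) = a^(-v) S_(k+v), which tends to zero. *)
Lemma shifted_vanishing Q :
  padic_vanishing (fun k => a%:~R ^+ k * T (shifted k Q)).
Proof.
suff H v : padic_vanishing (fun k => a%:~R ^+ k *
    T ((Q \Po ('X + k%:R%:P)) * rising (k + v))).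
  move=> e /(H 0%N)[N HN]; exists N => k /HN.
  by rewrite addn0 mulrC /shifted [rising _ * _]mulrC [a%:~R ^+ k * _]mulrC.
elim/poly_ind: Q v => [|Q x IH] v.
  by move=> e e0; exists 0%N => k _; rewrite comp_poly0 mul0r raddf0 mulr0 padic_abs0.
have B : padic_vanishing (fun k => a%:~R ^+ k * T (rising (k + v))).
  have := padic_vanishingZ (a%:~R ^- v) (padic_vanishing_shift v S_vanishing).
  move=> H e /H[N HN]; exists N => k /HN.
  rewrite rising_fun_rising /form_coef exprD invfM -mulrA.
  by rewrite mulVKf ?expf_neq0.
have := padic_vanishingD (padic_vanishingD (IH v.+1) (padic_vanishingZ (- v%:R) (IH v)))
  (padic_vanishingZ x B).
move=> H e /H[N HN]; exists N => k /HN.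
suff -> : T (((Q * 'X + x%:P) \Po ('X + k%:R%:P)) * rising (k + v)) =
  T ((Q \Po ('X + k%:R%:P)) * rising (k + v.+1)) -
  v%:R * T ((Q \Po ('X + k%:R%:P)) * rising (k + v)) + x * T (rising (k + v)).
  by congr (abs _ < e); ring.
rewrite comp_polyD comp_polyM comp_polyX comp_polyC mulrDl mul_polyC.
rewrite linearD linearZ /=; congr (_ + _).
rewrite mulrDr mulrDl linearD /= rising_funXM addnS natrD -mulrA mul_polyC -scalerAr linearZ /=.
by ring.
Qed.

(** In the iterated relation (1) the terms with k < n vanish. For k >= n, one factor |n!|_p comes
    from (alpha_j)_k and m more from P_n(alpha_j + k), a product of m falling products of length
    n. *)
Lemma padic_abs_rising_fun n i :
  abs (T (pade_poly alpha n * 'X^i)) <= abs n`!%:R ^+ m.+1.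
Proof.
set e := abs _ ^+ m.+1; pose Q := pade_poly alpha n * 'X^i.
have e0 : 0 < e.
  by rewrite exprn_gt0 // padic_abs_fact invr_gt0 exprn_gt0 // ltr0n prime_gt0.
have [N /(_ N (leqnn N)) HN] := shifted_vanishing Q e0.
have c_rec v := @form_coef_rec m alpha a l v a_neq0.
rewrite (rising_fun_unroll c_rec N Q).
apply: le_trans (padic_absD p_pr _ _) _; rewrite ge_max (ltW HN) padic_absN /=.
apply: padic_abs_sum_le => [|k _]; first exact: ltW.
rewrite padic_absM // -[e]mul1r ler_pM ?padic_abs_ge0 //.
  by rewrite padic_abs_exp exprn_ile1 ?padic_abs_ge0 ?padic_abs_int_le1.
rewrite eval_form_shifted; apply: padic_abs_sum_le => [|j _]; first exact: ltW.
rewrite padic_absM // -[e]mul1r ler_pM ?padic_abs_ge0 ?padic_abs_int_le1 //.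
have [kn|nk] := ltnP k n.
  by rewrite /Q hornerM horner_pade_poly_small // mul0r mulr0 padic_abs0 ltW.
have [r aE] := alpha_frac j.
rewrite /e exprS padic_absM //; apply: ler_pM; rewrite ?padic_abs_ge0 //.
  by rewrite aE padic_abs_pochhammer.
rewrite /Q hornerM padic_absM // -[_ ^+ m]mulr1.
apply: ler_pM; rewrite ?padic_abs_ge0 //; last first.
  rewrite hornerXn padic_abs_exp exprn_ile1 ?padic_abs_ge0 //.
  apply: le_trans (padic_absD p_pr _ _) _.
  by rewrite ge_max padic_abs_nat_le1 aE padic_abs_frac_le1.
rewrite horner_pade_poly padic_abs_prod.
have -> : abs n`!%:R ^+ m = \prod_(q < m) abs n`!%:R by rewrite prodr_const card_ord.
apply: ler_prod => q _; rewrite padic_abs_ge0 /=.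
have [t qE] := alpha_frac q.
have -> : alpha j + k%:R - alpha q = (r + k%:Z * s%:Z - t)%:~R / s%:R.
  by rewrite aE qE intrB intrD intrM -!pmulrn; field.
exact: padic_abs_falling.
Qed.

End FormBound.

Local Open Scope classical_set_scope.

(** When L_p = 0, S_n is the difference between S_n and its p-adic limit L_p. *)
Lemma linear_form_vanishing m (alpha : 'I_m -> rat) (a : int) (l : 'I_m.+1 -> int) :
  (forall j, ~~ (p %| `|denq (alpha j)|)%N) ->
  linear_form p_pr alpha a l = 0 -> padic_vanishing (partial_form alpha a l).
Proof.
move=> pd L0 e e0.
pose t j n := rat_padic p_pr (pochhammer (alpha j) n) * a%:~R ^+ n.
have /choice[N HN] (j : 'I_m) : exists N : nat, forall n, (N <= n)%N ->
    padic_norm (series (t j) n - phi (p_pr := p_pr) (alpha j) a%:~R) < e.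
  have cv : series (t j) @ \oo --> phi (p_pr := p_pr) (alpha j) a%:~R.
    exact: phi_cvg (pd j) (padic_norm_int_le1 p_pr a).
  have /cvg_ballP/(_ e e0)[N _ HN] := cv; exists N => n Nn.
  have : ball (phi (p_pr := p_pr) (alpha j) a%:~R) e (series (t j) n) by exact: HN.
  by rewrite padic_ballE /= padic_norm_distC.
exists (\max_(j < m) N j)%N => n Nn.
rewrite -(padic_norm_rat p_pr).
have -> : rat_padic p_pr (partial_form alpha a l n) =
    \sum_(j < m) (l (lift ord0 j))%:~R *
      (series (t j) n - phi (p_pr := p_pr) (alpha j) a%:~R).
  rewrite -[LHS]subr0 -[X in _ - X]L0 /linear_form /partial_form rmorphD rmorph_int.
  rewrite opprD addrACA subrr add0r rmorph_sum -sumrB; apply: eq_bigr => j _ /=.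
  rewrite rmorphM rmorph_int mulrBr; congr (_ * _ - _).
  rewrite /series /= big_mkord rmorph_sum; apply: eq_bigr => k _.
  by rewrite rmorphM rmorphXn rmorph_int.
apply: (big_ind (fun x => padic_norm x < e)) => [|x y|j _].
- by rewrite padic_norm0.
- exact: padic_normD_lt.
rewrite padic_normM; apply: le_lt_trans (HN j n _).
  by rewrite ler_piMl ?padic_norm_ge0 ?padic_norm_int_le1.
exact: leq_trans (leq_bigmax j) Nn.
Qed.

End PadicBounds.

(** * Elementary bounds for natural numbers *)

Section NatBounds.
Local Open Scope nat_scope.

Lemma bin_le_exp2 n k : 'C(n, k) <= 2 ^ n.
Proof.
elim: n k => [|n IH] [|k]; rewrite ?bin0 ?bin0n ?expn_gt0 //.
by rewrite binS expnS mul2n -addnn leq_add.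
Qed.

Lemma prime_dvd_fact p n : prime p -> p %| n`! -> p <= n.
Proof.
move=> p_pr; elim: n => [|n IH]; first by rewrite dvdn1 => /eqP p1; rewrite p1 in p_pr.
by rewrite factS Euclid_dvdM // => /orP[/dvdn_leq -> //|/IH/leqW].
Qed.

Lemma prod_shift_le A k : \prod_(i < k) (A + i) <= k`! * 2 ^ (A + k).
Proof.
have E : (\prod_(i < k) (A + i.+1)) * A`! = (A + k)`!.
  elim: k => [|k IH]; first by rewrite big_ord0 mul1n addn0.
  by rewrite big_ord_recr /= mulnAC IH addnS factS mulnC.
apply: (@leq_trans (\prod_(i < k) (A + i.+1))).
  by apply: leq_prod => i _; rewrite leq_add2l.
rewrite -(leq_pmul2r (fact_gt0 A)) E.
have /bin_fact <- : k <= A + k by apply: leq_addl.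
by rewrite addnK mulnA leq_mul2r [k`! * _]mulnC leq_mul2r bin_le_exp2 !orbT.
Qed.

(* Collects the geometric factors in the estimate of the integer
   a^N s^(2N) T(P), where N <= M = 2 n m is the degree of P. *)
Lemma geometric_factors_le m n A a s N i :
  0 < n -> 0 < a -> 0 < s -> i <= m -> N = i + n * m ->
  a ^ N * s ^ N.*2 * (1 + m * N * (2 ^ (A + N) * a ^ N)) * N ^ i *
    2 ^ ((N + A + n) * m) <=
  ((a * s) ^ (4 * m) * 2 ^ (3 * (m + A) + 4 * (m * m) + m * (A + 5))) ^ n.
Proof.
move=> n0 a0 s0 im NE; pose M := (2 * m) * n.
have NM : N <= M by rewrite /M NE; nia.
have expM b : 0 < b -> b ^ N <= b ^ M by move=> b0; apply: leq_pexp2l.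
have N2 : N <= 2 ^ M by apply: leq_trans NM _; apply: ltnW; apply: ltn_expl.
have H1 : 1 + m * N * (2 ^ (A + N) * a ^ N) <= 2 ^ m * (2 ^ M * (2 ^ (A + M) * a ^ M)).
  have x1 : 0 < 2 ^ M * (2 ^ (A + M) * a ^ M) by rewrite !muln_gt0 !expn_gt0 a0.
  have x2 : N * (2 ^ (A + N) * a ^ N) <= 2 ^ M * (2 ^ (A + M) * a ^ M).
    by rewrite leq_mul // leq_mul ?expM // leq_pexp2l // leq_add2l.
  have x3 : m < 2 ^ m by apply: ltn_expl.
  rewrite -mulnA.
  apply: (@leq_trans (m.+1 * (2 ^ M * (2 ^ (A + M) * a ^ M)))); last by rewrite leq_mul2r x3 orbT.
  by rewrite mulSn leq_add // leq_mul2l x2 orbT.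
have H2 : s ^ N.*2 <= s ^ M.*2 by apply: leq_pexp2l; rewrite ?leq_double.
have H3 : N ^ i <= 2 ^ (M * m).
  have [->|N0] := posnP N.
    by case: (i) => [|i']; rewrite ?expn0 ?exp0n // expn_gt0.
  rewrite expnM; apply: (@leq_trans (N ^ m)); first exact: leq_pexp2l.
  have [->|m0] := posnP m; first by rewrite !expn0.
  by rewrite leq_exp2r.
have H4 : 2 ^ ((N + A + n) * m) <= 2 ^ ((M + A + n) * m).
  by apply: leq_pexp2l => //; rewrite leq_mul2r !leq_add2r NM orbT.
apply: leq_trans (leq_mul (leq_mul (leq_mul (leq_mul (expM a a0) H2) H1) H3) H4) _.
have -> : a ^ M * s ^ M.*2 * (2 ^ m * (2 ^ M * (2 ^ (A + M) * a ^ M))) *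
    2 ^ (M * m) * 2 ^ ((M + A + n) * m) =
  (a * s) ^ M.*2 * 2 ^ (m + M + (A + M) + M * m + (M + A + n) * m).
  by rewrite -addnn !expnD !expnMn; ring.
rewrite [leqRHS]expnMn -!expnM leq_mul //.
  by rewrite leq_eqVlt; apply/orP; left; apply/eqP; congr (_ ^ _); rewrite /M; lia.
apply: leq_pexp2l => //; rewrite /M; nia.
Qed.

End NatBounds.

(** * The auxiliary integer and the resulting bound for [n!] *)

Section Core.
Variables (m : nat) (alpha : 'I_m -> rat) (a : int).
Hypothesis a_neq0 : a != 0.
Let s := (\big[lcmn/1]_(j < m) `|denq (alpha j)|)%N.

Lemma lcm_denq_gt0 : (0 < s)%N.
Proof.
rewrite /s; apply: (big_ind (fun x => 0 < x)%N) => // [x y x0 y0|j _].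
  by rewrite lcmn_gt0 x0.
by rewrite absz_gt0 denq_neq0.
Qed.

Lemma denq_dvd_lcm j : (`|denq (alpha j)| %| s)%N.
Proof. by rewrite /s (bigD1 j) //= dvdn_lcml. Qed.

Lemma alpha_frac j : exists r : int, alpha j = r%:~R / s%:R.
Proof.
have /dvdnP[k sE] := denq_dvd_lcm j.
have s0 : (s%:R : rat) != 0 by rewrite pnatr_eq0 -lt0n lcm_denq_gt0.
exists (k%:Z * numq (alpha j)); apply: (mulIf s0); rewrite divfK //.
have -> : s%:R = k%:R * (denq (alpha j))%:~R :> rat.
  by rewrite sE natrM [X in _ * X]pmulrn absz_denq.
by rewrite intrM numqE -pmulrn; ring.
Qed.

Lemma alpha_int j : s%:R * alpha j \is a Num.int.
Proof.
have s0 : (s%:R : rat) != 0 by rewrite pnatr_eq0 -lt0n lcm_denq_gt0.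
by have [r ->] := alpha_frac j; rewrite mulrC divfK // intr_int.
Qed.

Let A := (\max_(j < m) `|numq (alpha j)|)%N.

Lemma alpha_le j : `|alpha j| <= A%:R.
Proof.
apply: (@le_trans _ _ (`|numq (alpha j)|%N)%:R); last by rewrite ler_nat leq_bigmax.
have -> : (`|numq (alpha j)|%N)%:R = `|(numq (alpha j))%:~R| :> rat.
  by rewrite pmulrn abszE intr_norm.
rewrite numqE normrM ler_peMr // ger0_norm ?ler0z ?denq_ge0 //.
by rewrite ler1z -gtz0_ge1 denq_gt0.
Qed.

Lemma pochhammer_le j k : `|pochhammer (alpha j) k| <= (k`! * 2 ^ (A + k))%:R.
Proof.
apply: (@le_trans _ _ (\prod_(i < k) (A + i))%:R); last by rewrite ler_nat prod_shift_le.
rewrite /pochhammer normr_prod natr_prod; apply: ler_prod => i _; rewrite normr_ge0 /=.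
by apply: le_trans (ler_normD _ _) _; rewrite normr_nat natrD lerD2r alpha_le.
Qed.

(** The roots of P_n x^i with multiplicity, in the shape used by [rising_fun_int] and
    [rising_fun_le]. *)
Definition pade_roots n i : seq rat :=
  nseq i 0 ++ [seq alpha j + k%:R | k <- iota 0 n, j <- enum 'I_m].

Lemma size_pade_roots n i : size (pade_roots n i) = (i + n * m)%N.
Proof. by rewrite size_cat size_nseq size_allpairs size_iota size_enum_ord. Qed.

Lemma big_pade_roots n i (F : rat -> rat) :
  \prod_(b <- pade_roots n i) F b =
  F 0 ^+ i * \prod_(k < n) \prod_(j < m) F (alpha j + k%:R).
Proof.
rewrite big_cat big_nseq /= iter_mulr_1 big_allpairs_dep /=; congr (_ * _).
rewrite -[n in iota _ n]subn0 -/(index_iota 0 n) big_mkord.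
by apply: eq_bigr => k _; rewrite big_enum.
Qed.

Lemma pade_roots_poly n i :
  \prod_(b <- pade_roots n i) ('X - b%:P) = pade_poly alpha n * 'X^i.
Proof.
rewrite big_cat big_nseq /= iter_mulr_1 big_allpairs_dep /= subr0 mulrC; congr (_ * _).
rewrite -[n in iota _ n]subn0 -/(index_iota 0 n) big_mkord.
by apply: eq_bigr => k _; rewrite big_enum.
Qed.

Lemma pade_roots_int n i b : b \in pade_roots n i -> s%:R * b \is a Num.int.
Proof.
rewrite mem_cat => /orP[/nseqP[-> _]|/allpairsP[[k j] /= [_ _ ->]]].
  by rewrite mulr0 rpred0.
by rewrite mulrDr rpredD ?alpha_int // -natrM rpred_nat.
Qed.

Section Form.
Variable l : 'I_m.+1 -> int.
Let h := (\max_(i < m.+1) `|l i|)%N.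
Local Notation S := (partial_form alpha a l).
Local Notation c := (form_coef alpha a l).

Lemma coef_le_height i : `|(l i)%:~R| <= h%:R :> rat.
Proof.
have -> : `|(l i)%:~R| = (`|l i|%N)%:R :> rat by rewrite pmulrn abszE intr_norm.
by rewrite ler_nat leq_bigmax.
Qed.

Lemma form_coef_int v : (a%:~R * s%:R) ^+ v * c v \is a Num.int.
Proof.
have av : a%:~R ^+ v != 0 :> rat by rewrite expf_neq0 // intr_eq0.
rewrite exprMn /form_coef mulrACA divff // mul1r /partial_form mulrDr.
apply: rpredD; first by rewrite -natrX rpredM ?rpred_nat ?intr_int.
rewrite mulr_sumr rpred_sum // => j _; rewrite mulrCA rpredM ?intr_int //.
rewrite mulr_sumr rpred_sum // => k _.
have -> : s%:R ^+ v = s%:R ^+ (v - k) * s%:R ^+ k :> rat.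
  by rewrite -exprD subnK // ltnW.
rewrite -!mulrA rpredM //.
  by rewrite -natrX rpred_nat.
rewrite mulrA rpredM //; last by rewrite rpredX // intr_int.
have -> : s%:R ^+ k = \prod_(i < k) s%:R :> rat by rewrite prodr_const card_ord.
rewrite /pochhammer -big_split /= rpred_prod // => i _.
by rewrite mulrDr rpredD ?alpha_int // -natrM rpred_nat.
Qed.

Lemma form_coef_le X v : (v <= X)%N ->
  `|c v| <= (h * (1 + m * X * (2 ^ (A + X) * `|a| ^ X)))%:R * v`!%:R.
Proof.
move=> vX; have a1 : (0 < `|a|)%N by rewrite absz_gt0.
have aE : `|a%:~R| = (`|a|%N)%:R :> rat by rewrite pmulrn abszE intr_norm.
have cS : `|c v| <= `|S v|.
  rewrite /form_coef normrM ler_piMl // normfV normrX aE invf_le1.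
    by rewrite -natrX ler1n expn_gt0 a1.
  by rewrite exprn_gt0 // ltr0n.
apply: le_trans cS _; apply: le_trans (ler_normD _ _) _.
have Hsum j : `|\sum_(k < v) pochhammer (alpha j) k * a%:~R ^+ k| <=
    (X * (2 ^ (A + X) * `|a| ^ X) * v`!)%:R.
  apply: (@le_trans _ _ (\sum_(k < v) (2 ^ (A + X) * `|a| ^ X * v`!)%:R)).
    apply: le_trans (ler_norm_sum _ _ _) _; apply: ler_sum => k _.
    rewrite normrM normrX aE -natrX.
    apply: (@le_trans _ _ ((k`! * 2 ^ (A + k))%:R * (`|a| ^ k)%:R)).
      by rewrite ler_wpM2r // pochhammer_le.
    have kv : (k <= v)%N := ltnW (ltn_ord k).
    have kX := leq_trans kv vX.
    rewrite -natrM ler_nat mulnC mulnA [(_ * k`!)%N]mulnC -mulnA.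
    rewrite [leqRHS]mulnC leq_mul //.
      by rewrite -(bin_fact kv) mulnCA leq_pmulr // muln_gt0 bin_gt0 kv fact_gt0.
    by rewrite mulnC leq_mul // leq_pexp2l // leq_add2l.
  rewrite -natr_sum ler_nat sum_nat_const card_ord.
  by rewrite -mulnA -!mulnA leq_mul2r vX orbT.
apply: (@le_trans _ _ (h%:R + \sum_(j < m) h%:R * (X * (2 ^ (A + X) * `|a| ^ X) * v`!)%:R)).
  apply: lerD; first exact: coef_le_height.
  apply: le_trans (ler_norm_sum _ _ _) _; apply: ler_sum => j _.
  by rewrite normrM ler_pM // coef_le_height.
rewrite sumr_const card_ord -[_ *+ m]mulr_natr -!natrM -natrD ler_nat.
rewrite mulnDr muln1 mulnDl leq_add ?leq_pmulr ?fact_gt0 //.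
by rewrite leq_eqVlt; apply/orP; left; apply/eqP; ring.
Qed.

Hypothesis alpha_nonpos : forall (j : 'I_m) (k : nat), alpha j != - k%:R.
Hypothesis alpha_diff :
  forall i j : 'I_m, i != j -> alpha i - alpha j \isn't a Num.int.
Hypothesis l_neq0 : exists i, l i != 0.

Definition geometric_const : nat := ((`|a| * s) ^ (4 * m) *
  2 ^ (3 * (m + A) + 4 * (m * m) + m * (A + 5)))%N.

(** The integer is a^N s^(2N) T(P_n x^i), with N the degree of P_n x^i and i given by
    [rising_fun_neq0]. *)
Lemma pade_integer n : (0 < n)%N -> exists z : int, [/\ z != 0,
  (`|z| <= h * n`! ^ m * geometric_const ^ n)%N &
  forall p (p_pr : prime p), ~~ (p %| s)%N -> linear_form p_pr alpha a l = 0 ->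
    (p ^ (m.+1 * logn p n`!) %| `|z|)%N].
Proof.
move=> n0; have a1 : (0 < `|a|)%N by rewrite absz_gt0.
have s1 := lcm_denq_gt0; rewrite -/s in s1.
have ar0 : a%:~R != 0 :> rat by rewrite intr_eq0.
have sr0 : (s%:R : rat) != 0 by rewrite pnatr_eq0 -lt0n.
have aE : `|a%:~R| = (`|a|%N)%:R :> rat by rewrite pmulrn abszE intr_norm.
have c_rec v := @form_coef_rec m alpha a l v a_neq0.
have cl : (c 0 != 0) || [exists j, (l (lift ord0 j))%:~R != 0 :> rat].
  have [i li] := l_neq0; rewrite form_coef0 intr_eq0.
  have [j ij|ij] := unliftP ord0 i; last by rewrite -ij li.
  by apply/orP; right; apply/existsP; exists j; rewrite intr_eq0 -ij.
have [i im Ti] := rising_fun_neq0 c_rec ar0 alpha_nonpos alpha_diff n cl.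
set T := rising_fun _ _ in Ti; pose N := (i + n * m)%N.
have TE : T = rising_fun c (\prod_(b <- pade_roots n i) ('X - b%:P) * rising 0).
  by rewrite rising0 mulr1 pade_roots_poly.
have szN : (size (pade_roots n i) + 0)%N = N by rewrite size_pade_roots addn0.
have /intrP[z zE] : a%:~R ^+ N * s%:R ^+ N.*2 * T \is a Num.int.
  have := @rising_fun_int c a%:~R s%:R _ _ form_coef_int (pade_roots n i) 0.
  rewrite -TE !addn0 size_pade_roots; apply.
  - exact: intr_int.
  - exact: rpred_nat.
  by move=> b; apply: pade_roots_int.
exists z; split.
- rewrite -(intr_eq0 rat) -zE.
  by rewrite !mulf_neq0 ?expf_neq0.
- have Tle : `|T| <= (h * (1 + m * N * (2 ^ (A + N) * `|a| ^ N)) * N ^ i *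
      (n`! * 2 ^ (N + A + n)) ^ m)%:R.
    have := @rising_fun_le c (h * (1 + m * N * (2 ^ (A + N) * `|a| ^ N)))%:R N _
      (@form_coef_le N) (pade_roots n i) 0; rewrite -TE szN => /(_ _ _)/le_trans -> //.
    rewrite ffactn0 mulr1 big_pade_roots normr0 addr0 -natrX mulrA -natrM [leRHS]natrM.
    apply: ler_wpM2l => //.
    apply: (@le_trans _ _ (\prod_(k < n) \prod_(j < m) (N + A + k)%:R)).
      apply: ler_prod => k _; apply/andP; split.
        by apply: prodr_ge0 => j _; rewrite addr_ge0.
      apply: ler_prod => j _; rewrite addr_ge0 //= -addnA natrD lerD2l natrD.
      by apply: le_trans (ler_normD _ _) _; rewrite normr_nat lerD2r alpha_le.
    under eq_bigr do rewrite prodr_const card_ord -natrX.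
    by rewrite -natr_prod ler_nat -expn_prod; case: (m) => [|m']; rewrite ?expn0 // leq_exp2r // prod_shift_le.
  have := @geometric_factors_le m n A `|a| s N i n0 a1 s1 im erefl.
  rewrite -/geometric_const => G.
  have zle : (`|z|%N)%:R <= (`|a| ^ N * s ^ N.*2 * (h * (1 + m * N * (2 ^ (A + N) * `|a| ^ N)) * N ^ i *
      (n`! * 2 ^ (N + A + n)) ^ m))%:R :> rat.
    have -> : (`|z|%N)%:R = `|z%:~R| :> rat by rewrite pmulrn abszE intr_norm.
    rewrite -zE !normrM !normrX aE normr_nat natrM natrM !natrX.
    by apply: ler_wpM2l => //; rewrite mulr_ge0 // exprn_ge0.
  rewrite ler_nat in zle; apply: leq_trans zle _.
  apply: (@leq_trans (h * n`! ^ m * (`|a| ^ N * s ^ N.*2 * (1 + m * N * (2 ^ (A + N) * `|a| ^ N)) * N ^ i *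
    2 ^ ((N + A + n) * m)))%N); last by rewrite leq_mul2l G orbT.
  by rewrite expnMn -expnM leq_eqVlt; apply/orP; left; apply/eqP; ring.
move=> p p_pr ps L0.
have pd j : ~~ (p %| `|denq (alpha j)|)%N.
  by apply: contra ps => /dvdn_trans; apply; apply: denq_dvd_lcm.
have van := linear_form_vanishing pd L0.
have := padic_abs_rising_fun p_pr ps a_neq0 alpha_frac van n i; rewrite -/T => Tp.
have z0 : z != 0 by rewrite -(intr_eq0 rat) -zE !mulf_neq0 ?expf_neq0.
(* As p does not divide [s] and |a|_p <= 1, clearing denominators keeps the p-adic bound for T. *)
have : padic_abs p z%:~R <= p%:R ^- (m.+1 * logn p n`!).
  rewrite -zE !padic_absM // !padic_abs_exp // padic_abs_unit // expr1n mulr1.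
  rewrite mulnC -exprVn exprM exprVn -padic_abs_fact //.
  apply: le_trans Tp; rewrite ler_piMl ?padic_abs_ge0 //.
  by rewrite exprn_ile1 ?padic_abs_ge0 ?padic_abs_int_le1.
rewrite padic_absE // lef_pV2 ?posrE ?exprn_gt0 ?ltr0n ?prime_gt0 //.
rewrite ler_eXn2l ?ltr1n ?prime_gt1 // => le.
by rewrite pfactor_dvdn // absz_gt0.
Qed.

End Form.

Hypothesis alpha_nonpos : forall (j : 'I_m) (k : nat), alpha j != - k%:R.
Hypothesis alpha_diff :
  forall i j : 'I_m, i != j -> alpha i - alpha j \isn't a Num.int.

(** The (m+1)-st power of the good part of n! divides [z], so it is at most h n!^m C^n. Cancelling
    n!^m leaves n! at most h C^n times the (m+1)-st power of the bad part, which [fact_bad_part]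
    controls. *)
Lemma fact_le_height : exists2 C : nat, (0 < C)%N &
  forall (l : 'I_m.+1 -> int) (n y : nat), (exists i, l i != 0) ->
    (0 < n)%N -> (0 < y)%N ->
    (forall p (p_pr : prime p), ~~ (p %| s)%N -> (y < p <= n)%N ->
      linear_form p_pr alpha a l = 0) ->
  (n`! ^ 100 <= (\max_(i < m.+1) `|l i|) ^ 100 * C ^ n * y ^ (121 * m.+1 * n))%N.
Proof.
have [C2 C20 HC2] := fact_bad_part lcm_denq_gt0.
have C10 : (0 < geometric_const)%N.
  by rewrite muln_gt0 !expn_gt0 muln_gt0 absz_gt0 a_neq0 lcm_denq_gt0.
exists (geometric_const ^ 100 * C2 ^ m.+1)%N.
  by rewrite muln_gt0 !expn_gt0 C10 C20.
move=> l n y l0 n0 y0 L0; set h := (\max_(i < m.+1) `|l i|)%N.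
have [z [z0 zle zp]] := pade_integer alpha_nonpos alpha_diff l0 n0.
have := HC2 n y y0; set pi := [pred p | _] => Bad.
have dv : (n`!`_pi ^ m.+1 %| `|z|)%N.
  have pos : (0 < n`!`_pi ^ m.+1)%N by rewrite expn_gt0 part_gt0.
  (* A prime of the good part divides n!, so y < p <= n and L_p = 0. *)
  apply/(dvdn_partP _ pos) => p; rewrite pi_of_exp // => ppi.
  have : p \in primes n`!`_pi by [].
  rewrite primes_part mem_filter mem_primes => /and4P[pP p_pr _ pfact].
  have pn : (p <= n)%N by exact: prime_dvd_fact pfact.
  rewrite p_part lognX; apply: dvdn_trans (zp p p_pr _ _).
  - by rewrite dvdn_exp2l // leq_mul2l dvdn_leq_log ?fact_gt0 ?dvdn_part // orbT.
  - by case/andP: pP.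
  by apply: L0; case/andP: pP => // -> _.
have {}dv : (n`!`_pi ^ m.+1 <= h * n`! ^ m * geometric_const ^ n)%N.
  by apply: leq_trans zle; apply: dvdn_leq => //; rewrite absz_gt0.
have : (n`! <= h * geometric_const ^ n * n`!`_pi^' ^ m.+1)%N.
  rewrite -(@leq_pmul2l (n`! ^ m)) ?expn_gt0 ?fact_gt0 // -expnSr.
  rewrite -{1}(@partnC pi n`!) ?fact_gt0 // expnMn.
  apply: leq_trans (leq_mul dv (leqnn _)) _.
  by rewrite leq_eqVlt; apply/orP; left; apply/eqP; ring.
move: Bad dv => + _; move: (n`!`_pi^')%N 121%N => B e; move: 100%N => k.
have [->|k0] := posnP k; first by rewrite !expn0 => _ _; rewrite !mul1n muln_gt0 !expn_gt0 C20 y0.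
move=> Bad; rewrite -(leq_exp2r _ _ k0) => /leq_trans; apply.
apply: (@leq_trans (h ^ k * (geometric_const ^ k) ^ n * (C2 ^ n * y ^ (e * n)) ^ m.+1)).
  rewrite [leqLHS](_ : _ = h ^ k * (geometric_const ^ k) ^ n * (B ^ k) ^ m.+1)%N.
    by rewrite leq_mul2l leq_exp2r // Bad orbT.
  by rewrite !expnMn -!expnM [(n * k)%N]mulnC [(m.+1 * k)%N]mulnC.
by rewrite !expnMn -!expnM -!mulnA [(n * m.+1)%N]mulnC.
Qed.

End Core.

(** * Logarithmic estimates *)

Section RealEstimates.
Variable R : realType.

(** A weak Stirling bound: n log n - n grows by at most log (k + 1) from k to k + 1, as k log (1 +
    1/k) <= 1. *)
Lemma ln_fact_ge n : (0 < n)%N ->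
  n%:R * ln n%:R - n%:R <= ln (n`!%:R : R).
Proof.
elim: n => // -[_ _|n IH _]; first by rewrite ln1; lra.
have {IH} := IH isT; set k := n.+1 => IH.
have k0 : 0 < k%:R :> R by rewrite ltr0n.
have Sk : (k.+1%:R : R) = k%:R * (1 + k%:R^-1).
  by rewrite mulrDr mulr1 divff ?gt_eqF // natr1.
have i0 : 0 < (k%:R^-1 : R) by rewrite invr_gt0.
rewrite factS natrM lnM ?posrE ?ltr0n ?fact_gt0 //.
have lnS : ln (k.+1%:R : R) = ln k%:R + ln (1 + k%:R^-1).
  by rewrite Sk lnM ?posrE // addr_gt0.
have H : k%:R * ln (1 + k%:R^-1) <= (1 : R).
  rewrite -[leRHS](divff (lt0r_neq0 k0)) ler_pM2l //.
  by apply: le_ln1Dx; apply: lt_trans i0; rewrite oppr_lt0.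
rewrite -[k.+1%:R]natr1 natr1 lnS -[k.+1%:R]natr1; lra.
Qed.

Lemma ln_fact_power_le (k n h C y e : nat) :
  (0 < n)%N -> (0 < h)%N -> (0 < C)%N -> (0 < y)%N ->
  (n`! ^ k <= h ^ k * C ^ n * y ^ (e * n))%N ->
  k%:R * (n%:R * ln n%:R - n%:R) <= k%:R * ln (h%:R : R) + n%:R * ln C%:R +
    e%:R * n%:R * ln y%:R.
Proof.
move=> n0 h0 C0 y0 le.
have X0 (b i : nat) : (0 < b)%N -> (b ^ i)%:R \in @Num.pos R.
  by move=> b0; rewrite posrE ltr0n expn_gt0 b0.
have lnX (b i : nat) : (0 < b)%N -> ln ((b ^ i)%:R : R) = i%:R * ln b%:R.
  by move=> b0; rewrite natrX lnXn ?ltr0n // mulr_natl.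
have : ln ((n`! ^ k)%:R : R) <= ln ((h ^ k)%:R * (C ^ n)%:R * (y ^ (e * n))%:R).
  rewrite ler_ln ?rpredM ?X0 ?fact_gt0 // -!natrM ler_nat //.
rewrite !lnM ?rpredM ?X0 // !lnX ?fact_gt0 // natrM.
by apply: le_trans; rewrite ler_wpM2l // ln_fact_ge.
Qed.

Lemma ln_fact_height_le (n h C y q : nat) :
  (0 < n)%N -> (0 < h)%N -> (0 < C)%N -> (0 < y)%N ->
  (n`! ^ 100 <= h ^ 100 * C ^ n * y ^ (121 * q * n))%N ->
  n%:R * ln n%:R - n%:R <= ln (h%:R : R) + ln C%:R / 100 * n%:R +
    121 / 100 * q%:R * n%:R * ln y%:R.
Proof.
move=> n0 h0 C0 y0 /(ln_fact_power_le n0 h0 C0 y0); rewrite natrM; lra.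
Qed.

(** Here u is log H. Put w = log u, v = sqrt w, t = u / v^3. Then n is about t (v + c), and log n -
    1 - c1 - (121/100) q sqrt(log n) is at least v (v - b). As c - 1 > b, the product exceeds t v^3
    = u for large v. *)
Lemma Htilde_growth (q c1 : R) : 0 <= q -> 0 <= c1 ->
  exists2 W0 : R, 0 < W0 & forall (u : R) (n : nat), expR W0 <= u ->
    let X := u / ln u * (1 + (5 / 4 * q + 6) / Num.sqrt (ln u)) in
    n%:R <= X -> X < n%:R + 1 ->
    (0 < n)%N /\ u + c1 * n%:R + 121 / 100 * q * n%:R * Num.sqrt (ln n%:R) <
      n%:R * ln n%:R - n%:R.
Proof.
move=> q0 c10; pose c := 5 / 4 * q + 6; pose b := 121 / 100 * q + 1.
(* [x0] dominates all thresholds needed below; it is compared with the fourth root [x] of w, whence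
   its fourth power as [W0]. *)
pose x0 := 5 + c1 + c + b * (c - 1).
have cb : 0 <= b * (c - 1) by apply: mulr_ge0; rewrite /b /c; lra.
have c6 : 6 <= c by rewrite /c; lra.
have x01 : 5 <= x0 by rewrite /x0; lra.
exists (x0 ^+ 4); first by rewrite exprn_gt0 //; lra.
move=> u n uW X nX Xn; rewrite /X -/c in nX Xn; set w := ln u in nX Xn *.
have u0 : 0 < u by apply: lt_le_trans uW; apply: expR_gt0.
have uE : expR w = u by rewrite /w lnK.
have wW : x0 ^+ 4 <= w by rewrite -ler_expR uE.
have w0 : 0 < w by apply: lt_le_trans wW; rewrite exprn_gt0 //; lra.
set v := Num.sqrt w in nX Xn *.
have v0 : 0 <= v by rewrite sqrtr_ge0.
have vv : v ^+ 2 = w by rewrite sqr_sqrtr // ltW.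
have vx : x0 ^+ 2 <= v.
  by rewrite -(@ler_pXn2r _ 2) ?nnegrE ?exprn_ge0 ?vv -?exprM //; lra.
pose x := Num.sqrt v.
have xx : x ^+ 2 = v by rewrite sqr_sqrtr.
have x_ge0 : 0 <= x by rewrite sqrtr_ge0.
have xge : x0 <= x.
  by rewrite -(@ler_pXn2r _ 2) ?nnegrE ?xx //; lra.
have vx0 : x0 <= v by apply: le_trans vx; rewrite expr2; nra.
have lnw : ln w <= 4 * x.
  have xp : 0 < x by lra.
  have -> : w = x ^+ 4 by rewrite -vv -xx -exprM.
  by rewrite lnXn // -[_ *+ 4]mulr_natl ler_pM2l // ltW // ln_sublinear.
have lnwc : ln w + (1 + c1) <= v.
  rewrite -xx expr2; apply: le_trans (lerD lnw (lexx _)) _.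
  have : c1 + 5 <= x by apply: le_trans xge; rewrite /x0; lra.
  nra.
have uv : v ^+ 3 <= u.
  rewrite -uE; have := @expR_ge1Dxn R w 1 (ltW w0); rewrite /= => H.
  apply: le_trans H; have -> : (2`!%:R : R) = 2 by [].
  have : 0 <= v ^+ 3 * (v - 2) by rewrite mulr_ge0 ?exprn_ge0 //; lra.
  by rewrite -vv; lra.
pose t := u / v ^+ 3.
have vp : 0 < v by lra.
have v3 : 0 < v ^+ 3 by rewrite exprn_gt0.
have ut : u = t * v ^+ 3 by rewrite /t divfK // gt_eqF.
have t1 : 1 <= t by rewrite /t ler_pdivlMr // mul1r.
have XE : u / w * (1 + c / v) = t * (v + c).
  by rewrite ut -vv; field; rewrite gt_eqF.
rewrite XE in nX Xn.
(* Since n > X - 1 and t >= 1, taking the integer part at most lowers c to c - 1. *)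
have nge : t * (v + c - 1) <= n%:R.
  have : t * (v + c - 1) = t * (v + c) - t by ring.
  lra.
have ntv : t * v <= n%:R by apply: le_trans nge; rewrite ler_pM2l //; lra.
have tv1 : 1 <= t * v by nra.
have n1 : 1 <= n%:R :> R by apply: le_trans ntv.
have n0 : (0 < n)%N by rewrite -(ltr_nat R); lra.
split => //.
have lnn_le : ln n%:R <= w.
  rewrite -[w]expRK uE ler_ln ?posrE ?ltr0n //; apply: le_trans nX _.
  rewrite ut ler_pM2l; last by lra.
  have : c <= v by apply: le_trans vx0; rewrite /x0; lra.
  by rewrite !exprS expr0; nra.
have sq_le : Num.sqrt (ln n%:R) <= v by rewrite /v ler_sqrt // ltW.
(* The lower bound t v for n equals u / w, whose logarithm is w - log w. *)
have lnn_ge : w - ln w <= ln n%:R.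
  have -> : w - ln w = ln (t * v).
    rewrite {1}/w -ln_div ?posrE //; congr ln.
    by rewrite ut -vv; field; rewrite gt_eqF.
  by rewrite ler_ln ?posrE ?ltr0n //; lra.
have bv : b <= v.
  apply: le_trans vx0; rewrite /x0; have : b <= b * (c - 1).
    by rewrite ler_peMr // /b; lra.
  lra.
have main : u < n%:R * (v * (v - b)).
  apply: (@lt_le_trans _ _ (t * (v + c - 1) * (v * (v - b)))); last first.
    by rewrite ler_wpM2r // mulr_ge0 //; lra.
  (* The coefficient c - 1 - b is 4 + q / 25, because 5/4 - 121/100 = 1/25. *)
  have gain : 0 < (c - 1 - b) * v - b * (c - 1).
    have h1 : 4 * v <= (c - 1 - b) * v by rewrite ler_pM2r // /c /b; lra.
    have : b * (c - 1) < v by apply: lt_le_trans vx0; rewrite /x0; lra.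
    lra.
  rewrite -subr_gt0 ut.
  have -> : t * (v + c - 1) * (v * (v - b)) - t * v ^+ 3 =
      t * v * ((c - 1 - b) * v - b * (c - 1)) by ring.
  by rewrite mulr_gt0 //; lra.
have final : n%:R * (v * (v - b)) <=
    n%:R * (ln n%:R - 1 - c1 - 121 / 100 * q * Num.sqrt (ln n%:R)).
  rewrite ler_wpM2l //.
  have h1 : 121 / 100 * q * Num.sqrt (ln n%:R) <= 121 / 100 * q * v.
    by rewrite ler_wpM2l //; lra.
  have -> : v * (v - b) = w - v - 121 / 100 * q * v by rewrite -vv /b; ring.
  lra.
have := lt_le_trans main final.
have -> : n%:R * (ln n%:R - 1 - c1 - 121 / 100 * q * Num.sqrt (ln n%:R)) =
  n%:R * ln n%:R - n%:R - c1 * n%:R - 121 / 100 * q * n%:R * Num.sqrt (ln n%:R) by ring.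
lra.
Qed.

End RealEstimates.

(** * Choice of n and y in both assertions *)

Lemma height_gt0 m (l : 'I_m.+1 -> int) : (exists i, l i != 0) ->
  (0 < \max_(i < m.+1) `|l i|)%N.
Proof.
move=> [i li]; apply: (@leq_trans `|l i|%N); first by rewrite absz_gt0.
exact: (leq_bigmax (F := fun i => `|l i|%N)).
Qed.

Theorem theorem2 (R : realType) (m : nat) (alpha : 'I_m -> rat) (a : int)
    (m_ge1 : (1 <= m)%N)
    (alpha_nonpos : forall (j : 'I_m) (k : nat), alpha j != - k%:R)
    (alpha_diff : forall i j : 'I_m, i != j -> alpha i - alpha j \isn't a Num.int)
    (a_neq0 : a != 0) :
  let s := (\big[lcmn/1]_(j < m) `|denq (alpha j)|)%N in
  (forall l : 'I_m.+1 -> int, (exists i, l i != 0) ->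
     infinite_set [set p : nat | exists p_pr : prime p,
       ~~ (p %| s)%N /\ linear_form p_pr alpha a l != 0]) /\
  (exists H0 : R, expR 1 < H0 /\
     forall l : 'I_m.+1 -> int, (exists i, l i != 0) ->
       let h := (\max_(i < m.+1) `|l i|)%N in
       let H := Num.max h%:R H0 in
       let Ht : R := (Htilde m H)%:~R in
       exists (p : nat) (p_pr : prime p),
         [/\ ~~ (p %| s)%N,
             expR (Num.sqrt (ln Ht)) < p%:R,
             p%:R <= m%:R * Ht
           & linear_form p_pr alpha a l != 0]).
Proof.
move=> s; have [C C0 HC] := fact_le_height a_neq0 alpha_nonpos alpha_diff.
have c10 : 0 <= ln (C%:R : R) / 100 by rewrite divr_ge0 // ln_ge0 // ler1n.
split=> [l l0 /finite_seqP[ps psE]|].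
  have h0 := height_gt0 l0; set h := (\max_(i < m.+1) `|l i|)%N in h0.
  (* [y] exceeds the supposedly finitely many primes with L_p nonzero; it stays fixed while n is
     taken large. *)
  pose y := (\max_(p <- ps) p).+1.
  have L0 p (p_pr : prime p) : ~~ (p %| s)%N -> (y < p)%N ->
      linear_form p_pr alpha a l = 0.
    move=> p_s yp; apply/eqP/negPn/negP => Lp.
    have : p \in ps.
      by have : [set` ps] p by rewrite -psE; exists p_pr.
    move=> /(leq_bigmax_seq (F := id) (P := xpredT))/(_ isT) /=.
    by rewrite leqNgt (ltn_trans _ yp) // /y.
  (* [K] collects the coefficients of n in the height bound, log h being replaced by n log h; log n
     > K is then a contradiction. *)
  pose K := 1 + ln (h%:R : R) + ln C%:R / 100 + 121 / 100 * m.+1%:R * ln y%:R.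
  pose n := (Num.truncn (expR K)).+1.
  have nK : expR K < n%:R by apply: truncnS_gt.
  have n1 : 1 <= n%:R :> R by rewrite ler1n.
  have n0 : (0 < n)%N by [].
  have y0 : (0 < y)%N by [].
  have Ln p (p_pr : prime p) : ~~ (p %| s)%N -> (y < p <= n)%N ->
    linear_form p_pr alpha a l = 0 by move=> p_s /andP[/L0 Lp _]; apply: Lp.
  have := ln_fact_height_le R n0 h0 C0 y0 (HC l n y l0 n0 y0 Ln).
  have Kln : K < ln n%:R by rewrite -ltr_expR lnK // posrE ltr0n.
  have lnh : 0 <= ln (h%:R : R) by rewrite ln_ge0 // ler1n.
  have : n%:R * K < n%:R * ln n%:R by rewrite ltr_pM2l // ltr0n.
  have : ln (h%:R : R) <= n%:R * ln h%:R by rewrite ler_peMl.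
  rewrite /K !mulrDr mulr1.
  have -> : 121 / 100 * m.+1%:R * n%:R * ln y%:R =
    n%:R * (121 / 100 * m.+1%:R * ln y%:R) :> R by ring.
  lra.
have [W0 W00 HW] := Htilde_growth (ler0n R m.+1) c10.
(* The double exponential ensures log H >= exp W0, as [Htilde_growth] asks. *)
exists (expR (expR W0)); split; first by rewrite ltr_expR -expR0 ltr_expR.
move=> l l0 h H Ht.
have h0 : (0 < h)%N := height_gt0 l0.
have HH0 : expR (expR W0) <= H by rewrite /H le_max lexx orbT.
have H_gt0 : 0 < H by apply: lt_le_trans HH0; apply: expR_gt0.
have uW : expR W0 <= ln H by rewrite -ler_expR lnK.
have lnhH : ln h%:R <= ln H by rewrite ler_ln ?posrE ?ltr0n // /H le_max lexx.
set X := ln H / ln (ln H) * (1 + (5 / 4 * m.+1%:R + 6) / Num.sqrt (ln (ln H))).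
have u0 : 0 < ln H by apply: lt_le_trans uW; apply: expR_gt0.
have w0 : 0 < ln (ln H).
  by apply: (lt_le_trans W00); rewrite -[W0]expRK ler_ln ?posrE ?expR_gt0.
have X0 : 0 <= X.
  apply: mulr_ge0; first by rewrite divr_ge0 // ltW.
  have : 0 <= m.+1%:R :> R by [].
  by move=> ?; apply: addr_ge0 => //; apply: divr_ge0; [lra|exact: sqrtr_ge0].
pose n := Num.truncn X.
have HtE : Ht = n%:R.
  by rewrite /Ht /Htilde -/X /n truncn_floor X0 pmulrn gez0_abs ?floor_ge0.
have [nX Xn] := andP (truncn_itv X0); rewrite -/n -natr1 in nX Xn.
have [n0 growth] := HW (ln H) n uW nX Xn.
apply: contrapT => noP.
(* Rounding [E] down is harmless: p > y still gives p > E, and log y <= sqrt(log n). A prime p <= n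
   also satisfies p <= m n, as m >= 1. *)
pose E : R := expR (Num.sqrt (ln n%:R)); pose y := Num.truncn E.
have E1 : 1 <= E by rewrite -expR0 ler_expR sqrtr_ge0.
have y0 : (0 < y)%N by rewrite truncn_gt0.
have lny : ln y%:R <= Num.sqrt (ln n%:R) :> R.
  rewrite -[leRHS]expRK ler_ln ?posrE ?ltr0n ?expR_gt0 //.
  by rewrite /y truncn_le expR_ge0.
have L0 p (p_pr : prime p) : ~~ (p %| s)%N -> (y < p <= n)%N ->
    linear_form p_pr alpha a l = 0.
  move=> p_s /andP[yp pn]; apply/eqP/negPn/negP => Lp.
  apply: noP; exists p, p_pr; split => //; rewrite HtE.
    by apply: lt_le_trans (truncnS_gt _) _; rewrite ler_nat.
  by rewrite -natrM ler_nat (leq_trans pn) // leq_pmull.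
have := ln_fact_height_le R n0 h0 C0 y0 (HC l n y l0 n0 y0 L0).
have : 121 / 100 * m.+1%:R * n%:R * ln y%:R <=
    121 / 100 * m.+1%:R * n%:R * Num.sqrt (ln n%:R) :> R.
  by apply: ler_wpM2l lny; rewrite -mulrA mulr_ge0 ?mulr_ge0 //; lra.
lra.
Qed.
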